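(* Let $(M,c)$ be a four-dimensional manifold endowed with a pseudoconformal structure $c=CO(2,2)$ of signature $(2,2)$, and let $V\subset (M,c)$ be a lightlike hypersurface whose isotropic geodesics can be prolonged indefinitely. Let $\Delta_\alpha$ and $\Delta_\beta$ be the two isotropic two-dimensional distributions on $V$ formed by the $\alpha$-planes and the $\beta$-planes contained in the tangent subspaces $T_x(V)$. Then both distributions $\Delta_\alpha$ and $\Delta_\beta$ are integrable if and only if the hypersurface $V$ is totally umbilical.
   Context: Everything is smooth. Conformal structure and frames. $c$ is a conformal class of pseudo-Riemannian metrics of signature $(2,2)$; $C_x\subset T_x(M)$ is its isotropic (null) cone. The tangent space $T_x(M)$ is compactified to a pseudoconformal space, realized as a hyperquadric in a projective space $P^5_x$ with scalar product $(\cdot,\cdot)$, in which $x$ itself is a point. Isotropic frames $\{A_0,A_1,A_2,A_3,A_4,A_5\}$ of $P^5_x$ satisfy $A_0=x$, $(A_0,A_5)=-1$, $(A_1,A_4)=-1$, $(A_2,A_3)=1$, all other scalar products being zero; the points $A_1,\dots,A_4$ represent a basis of $T_x(M)$. The normal conformal (Cartan) connection is written $dA_0=\omega_0^0A_0+\omega^iA_i$, $dA_i=\omega_i^0A_0+\omega_i^jA_j+\omega_i^5A_5$, $dA_5=\omega_5^iA_i-\omega_0^0A_5$ ($i,j=1,\dots,4$), where $\omega_i^5=g_{ij}\omega^j$, $\omega_5^i=g^{ij}\omega_j^0$, $g_{ij}=(A_i,A_j)$, $g_{ik}\omega^k_j+g_{kj}\omega^k_i=0$; the conformal class is represented by $g=2(\omega^2\omega^3-\omega^1\omega^4)$.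 In particular $\omega_1^4=\omega_2^3=\omega_3^2=\omega_4^1=0$, $\omega_2^4=\omega_1^3$, $\omega_3^4=\omega_1^2$, and $d\omega^i=\omega_0^0\wedge\omega^i+\omega^j\wedge\omega^i_j$. The cone $C_x$: $\xi^2\xi^3-\xi^1\xi^4=0$ carries two families of two-dimensional plane generators: the $\alpha$-generators $\xi^1+\lambda\xi^3=0,\ \xi^2+\lambda\xi^4=0$ and the $\beta$-generators $\xi^1+\mu\xi^2=0,\ \xi^3+\mu\xi^4=0$ (with $\lambda,\mu\in\mathbf{R}\cup\{\infty\}$; for $\lambda=\infty$: $\xi^3=\xi^4=0$; for $\mu=\infty$: $\xi^2=\xi^4=0$). Lightlike hypersurfaces. A hypersurface $V\subset M$ ($\dim V=3$) is lightlike if, for each $x\in V$, $T_x(V)$ is tangent to $C_x$. Then $T_x(V)$ contains exactly one $\alpha$-generator and one $\beta$-generator, meeting in the isotropic line $l$ along which $T_x(V)$ is tangent to $C_x$. First-order frames of $V$: $A_0=x$, $A_1$ lies on $l=A_0A_1$, $A_0\wedge A_1\wedge A_2$ is the $\alpha$-plane and $A_0\wedge A_1\wedge A_3$ the $\beta$-plane. In such frames $V$ satisfies $\omega^4=0$, and $\omega^1,\omega^2,\omega^3$ are independent on $V$. The isotropic geodesics of $V$ are the lines $\omega^2=\omega^3=0$ on $V$; prolonged indefinitely, each carries the geometry of a projective line $P^1$, is identified with the projective line $A_0A_1$, and $V=f(M^2\times P^1)$ for a differentiable map $f$. The distributions are $\Delta_\alpha:\ \omega^3=0$ and $\Delta_\beta:\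 \omega^2=0$ on $V$. On $V$ one has $\omega_1^3=\lambda_{22}\omega^2+\lambda_{23}\omega^3$, $\omega_1^2=\lambda_{32}\omega^2+\lambda_{33}\omega^3$ with $\lambda_{23}=\lambda_{32}$. The first fundamental form is $I=2\omega^2\omega^3$; put $\widetilde{II}=\lambda_{22}(\omega^2)^2+2\lambda_{23}\omega^2\omega^3+\lambda_{33}(\omega^3)^2$. The conformally invariant second fundamental form is $II=\widetilde{II}-\lambda_{23}I=\lambda_{22}(\omega^2)^2+\lambda_{33}(\omega^3)^2$. $V$ is totally umbilical if $II$ vanishes identically on $V$ (equivalently, $\widetilde{II}$ is proportional to $I$ at every point). *)

(* Defs.v *)
(* Tangent vectors are row vectors: a Jacobian acts on the
   right, and a family of vectors is the matrix of its rows. *)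
From HB Require Import structures.
From mathcomp Require Import all_boot all_order all_algebra.
From mathcomp Require Import all_classical all_reals all_analysis.
Set Implicit Arguments.
Unset Strict Implicit.
Unset Printing Implicit Defensive.
Import Order.TTheory GRing.Theory Num.Theory numFieldNormedType.Exports.
Local Open Scope classical_set_scope.
Local Open Scope ring_scope.

(** * Smooth manifolds *)

(* For E of finite dimension and U open this is C^oo: all iterated directional
   derivatives exist and are differentiable on U. *)
Definition smooth_on (R : realType) (E F : normedModType R) (U : set E)
    (f : E -> F) : Prop :=
  forall (s : seq E) (x : E), U x ->
    differentiable (foldr (fun v h => 'D_v h) f s) x.

(* [cinv] is only meaningful on [cimg], and [cmap] on [cdom]. *)
Record chart (R : realType) (n : nat) (T : topologicalType) := Chart {
  cdom : set T;
  cimg : set 'rV[R]_n;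
  cmap : T -> 'rV[R]_n;
  cinv : 'rV[R]_n -> T;
  cdom_open : open cdom;
  cimg_open : open cimg;
  cmap_img : forall x, cdom x -> cimg (cmap x);
  cinv_dom : forall y, cimg y -> cdom (cinv y);
  cmapK : forall x, cdom x -> cinv (cmap x) = x;
  cinvK : forall y, cimg y -> cmap (cinv y) = y;
  cmap_continuous : forall x, cdom x -> {for x, continuous cmap};
  cinv_continuous : forall y, cimg y -> {for y, continuous cinv} }.

Definition transition (R : realType) (n : nat) (T : topologicalType)
    (a b : chart R n T) : 'rV[R]_n -> 'rV[R]_n :=
  cmap b \o cinv a.

Definition overlap (R : realType) (n : nat) (T : topologicalType)
    (a b : chart R n T) : set 'rV[R]_n :=
  cimg a `&` (cinv a @^-1` cdom b).

Definition compatible (R : realType) (n : nat) (T : topologicalType)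
    (a b : chart R n T) : Prop :=
  smooth_on (overlap a b) (transition a b) /\
  smooth_on (overlap b a) (transition b a).

Record manifold (R : realType) (n : nat) := Manifold {
  carrier :> topologicalType;
  atlas : set (chart R n carrier);
  manifold_hausdorff : hausdorff_space carrier;
  manifold_second_countable : @second_countable carrier;
  atlas_cover : forall x, exists2 a, atlas a & cdom a x;
  atlas_compatible : forall a b, atlas a -> atlas b -> compatible a b;
  atlas_maximal :
    forall a, (forall b, atlas b -> compatible a b) -> atlas a }.

(* Smoothness of F : U -> M. As the atlas is maximal, its chart domains are a
   basis of the topology, so the openness clause is the continuity of F. *)
Definition smooth_into (R : realType) (n m : nat) (M : manifold R m)
    (U : set 'rV[R]_n) (F : 'rV[R]_n -> M) : Prop :=
  forall phi, atlas phi ->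
    open (U `&` (F @^-1` cdom phi)) /\
    smooth_on (U `&` (F @^-1` cdom phi)) (cmap phi \o F).

Definition coord_rep (R : realType) (n m : nat) (N : manifold R n)
    (M : manifold R m) (f : N -> M) (chi : chart R n N) (phi : chart R m M) :
    'rV[R]_n -> 'rV[R]_m :=
  cmap phi \o f \o cinv chi.

Definition immersion (R : realType) (n m : nat) (N : manifold R n)
    (M : manifold R m) (f : N -> M) : Prop :=
  (forall chi, atlas chi -> smooth_into (cimg chi) (f \o cinv chi)) /\
  (forall chi phi y, atlas chi -> atlas phi -> cimg chi y ->
     cdom phi (f (cinv chi y)) -> row_free ('J (coord_rep f chi phi) y)).

(* A field of subsets of the tangent spaces: [dist D chi y X] says that the
   vector with components X in chi, at the point with coordinates y, is in D.
   Only the values on the atlas matter. *)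
Record plane_field (R : realType) (n : nat) (N : manifold R n) :=
  PlaneField {
    dist :> chart R n N -> 'rV[R]_n -> set 'rV[R]_n;
    dist_compatible : forall a b y X, atlas a -> atlas b -> overlap a b y ->
      dist a y X <-> dist b (transition a b y) (X *m 'J (transition a b) y) }.

(* Through every point there is a k-dimensional integral submanifold. *)
Definition integrable_distribution (R : realType) (n : nat)
    (N : manifold R n) (k : nat) (D : plane_field N) : Prop :=
  forall v : N, exists (chi : chart R n N) (O : set 'rV[R]_k)
      (h : 'rV[R]_k -> 'rV[R]_n),
    [/\ atlas chi, cdom chi v, open O, O 0 & h 0 = cmap chi v] /\
    [/\ smooth_on O h,
        forall u, O u -> cimg chi (h u),
        forall u, O u -> row_free ('J h u) &
        forall u X, O u -> D chi (h u) X <-> (X <= 'J h u)%MS].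

(** * Pseudoconformal structures CO(2,2) *)

Definition signature22 (R : realType) (G : 'M[R]_4) : Prop :=
  exists2 P : 'M[R]_4, P \in unitmx &
    P *m G *m P^T = diag_mx (\row_(i < 4) if (i < 2)%N then 1 else - 1).

(* In each chart a smooth metric representing the class; on overlaps the
   representatives agree up to a positive factor (necessarily smooth). *)
Record conformal22 (R : realType) (M : manifold R 4) := Conformal22 {
  metric : chart R 4 M -> 'rV[R]_4 -> 'M[R]_4;
  metric_smooth :
    forall phi, atlas phi -> smooth_on (cimg phi) (metric phi);
  metric_sym : forall phi x, atlas phi -> cimg phi x ->
    (metric phi x)^T = metric phi x;
  metric_signature : forall phi x, atlas phi -> cimg phi x ->
    signature22 (metric phi x);
  metric_conformal : forall phi psi x, atlas phi -> atlas psi ->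
    overlap phi psi x ->
    exists2 k : R, 0 < k &
      metric phi x = k *: ('J (transition phi psi) x
                           *m metric psi (transition phi psi x)
                           *m ('J (transition phi psi) x)^T) }.

Section NormalConnection.
Variables (R : realType) (G : 'rV[R]_4 -> 'M[R]_4).

Definition pderiv (i : 'I_4) (F : 'rV[R]_4 -> R) (x : 'rV[R]_4) : R :=
  'D_(delta_mx 0 i) F x.

Definition christoffel (k i j : 'I_4) (x : 'rV[R]_4) : R :=
  2^-1 * \sum_l invmx (G x) k l *
    (pderiv i (fun z => G z j l) x + pderiv j (fun z => G z i l) x
     - pderiv l (fun z => G z i j) x).

Definition ricci (x : 'rV[R]_4) : 'M[R]_4 :=
  \matrix_(i, j) \sum_k
    (pderiv k (christoffel k i j) x - pderiv j (christoffel k i k) x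
     + \sum_l (christoffel k k l x * christoffel l i j x
               - christoffel k j l x * christoffel l i k x)).

Definition scalar_curvature (x : 'rV[R]_4) : R :=
  \tr (invmx (G x) *m ricci x).

(* Minus the Schouten tensor. It is the choice of the omega_i^0 for which the
   conformal curvature
     d omega_i^j - omega_i^k /\ omega_k^j - omega_i^0 /\ omega^j
       - omega_i^5 /\ omega_5^j
   is trace-free, i.e. for which the connection is the normal one. *)
Definition normal_tensor (x : 'rV[R]_4) : 'M[R]_4 :=
  - 2^-1 *: (ricci x - (scalar_curvature x / 6) *: G x).

(* The metric G trivializes the bundle of the pseudo-Euclidean 6-spaces whose
   projectivizations are the P^5_x: it yields a frame (E_0, E_1..E_4, E_5),
   where E_0 is the point x, E_1..E_4 stand for the coordinate vectors, and
   (E_0,E_5) = -1, (E_i,E_j) = G_ij, the other scalar products being 0. *)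
Definition scalar_product (x : 'rV[R]_4) : 'M[R]_6 :=
  block_mx (block_mx 0 0 0 (G x) : 'M[R]_(1 + 4)) (col_mx (- 1)%:M 0)
           (row_mx (- 1)%:M 0) (0 : 'M[R]_1).

(* The normal conformal connection in this frame, evaluated on the tangent
   vector xi at x: row u lists the components of dE_u(xi). *)
Definition normal_connection (x xi : 'rV[R]_4) : 'M[R]_6 :=
  block_mx
    (block_mx 0 xi
       (normal_tensor x *m xi^T)
       (\matrix_(a, c) \sum_b christoffel c a b x * xi 0 b) : 'M[R]_(1 + 4))
    (col_mx 0 (G x *m xi^T))
    (row_mx 0 (xi *m normal_tensor x *m invmx (G x)))
    (0 : 'M[R]_1).

(* Derivative, in the direction X, of m sections (the rows of A) of the bundle
   pulled back along h. *)
Definition covariant_derivative (E : normedModType R) (h : E -> 'rV[R]_4)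
    (m : nat) (A : E -> 'M[R]_(m, 6)) (X y : E) : 'M[R]_(m, 6) :=
  'D_X A y + A y *m normal_connection (h y) ('D_X h y).

End NormalConnection.

(* (A_0,A_5) = (A_1,A_4) = -1, (A_2,A_3) = 1, the others being 0. *)
Definition isotropic_gram (R : realType) : 'M[R]_6 :=
  \matrix_(u, v) if (u + v == 5)%N then
                   if (nat_of_ord u) \in [:: 2; 3]%N then 1 else - 1
                 else 0.

(* The vector of the 6-space at x representing the point x itself. *)
Definition base_point (R : realType) : 'rV[R]_6 := delta_mx 0 ord0.

(** * Lightlike hypersurfaces *)

Section Hypersurface.
Variables (R : realType) (M : manifold R 4) (c : conformal22 M).
Variables (V : manifold R 3) (iota : V -> M).

(* For a null xi <> 0, the tangent hyperplane to the cone C_x along xi is the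
   orthogonal complement of xi. *)
Definition lightlike_hypersurface : Prop :=
  immersion iota /\
  forall chi phi y, atlas chi -> atlas phi -> cimg chi y ->
    cdom phi (iota (cinv chi y)) ->
    let g := metric c phi (coord_rep iota chi phi y) in
    exists xi : 'rV[R]_4,
      [/\ xi != 0, xi *m g *m xi^T = 0 &
          ('J (coord_rep iota chi phi) y == kermx (g *m xi^T))%MS].

(* X is tangent to the line l along which T_x(V) is tangent to C_x, i.e. to
   the isotropic geodesic of V. *)
Definition on_isotropic_line (chi : chart R 3 V) (phi : chart R 4 M)
    (y X : 'rV[R]_3) : Prop :=
  let J := 'J (coord_rep iota chi phi) y in
  X *m J *m metric c phi (coord_rep iota chi phi y) *m J^T = 0.

Section Frames.
Variables (chi : chart R 3 V) (phi : chart R 4 M) (A : 'rV[R]_3 -> 'M[R]_6).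

(* omega_u^v(X) at y, defined by dA_u = omega_u^v A_v along V. *)
Definition conn_form (u v : nat) (y X : 'rV[R]_3) : R :=
  (covariant_derivative (metric c phi) (coord_rep iota chi phi) A X y
   *m invmx (A y)) (inord u) (inord v).

(* omega^i = omega_0^i. *)
Definition coframe (i : nat) : 'rV[R]_3 -> 'rV[R]_3 -> R := conn_form 0 i.

(* A field of first-order frames A_0, ..., A_5 on the open set O of V: the rows
   of A y in the frame (E_0, ..., E_5). On V, omega^4 = 0 says that T_x(V) is
   spanned by A_1, A_2, A_3; then A_1 is on l, A_0 /\ A_1 /\ A_2 is the
   alpha-plane and A_0 /\ A_1 /\ A_3 the beta-plane. *)
Definition first_order_frame (O : set 'rV[R]_3) : Prop :=
  [/\ atlas chi, atlas phi, open O,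
      O `<=` cimg chi `&` ((iota \o cinv chi) @^-1` cdom phi) &
      smooth_on O A] /\
  forall y, O y ->
    [/\ exists2 r : R, r != 0 & row ord0 (A y) = r *: base_point R,
        A y *m scalar_product (metric c phi) (coord_rep iota chi phi y)
          *m (A y)^T = isotropic_gram R &
        forall X, coframe 4 y X = 0].

(* The basis e_1, e_2, e_3 of T(V) dual to omega^1, omega^2, omega^3. *)
Definition dual_basis (i : nat) (y : 'rV[R]_3) : 'rV[R]_3 :=
  row (inord i.-1)
    (invmx (\matrix_(a < 3, j < 3) coframe j.+1 y (delta_mx 0 a))).

(* The coefficients in omega_1^3 = lambda_22 omega^2 + lambda_23 omega^3 and
   omega_1^2 = lambda_23 omega^2 + lambda_33 omega^3. *)
Definition lambda22 (y : 'rV[R]_3) : R := conn_form 1 3 y (dual_basis 2 y).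
Definition lambda23 (y : 'rV[R]_3) : R := conn_form 1 3 y (dual_basis 3 y).
Definition lambda33 (y : 'rV[R]_3) : R := conn_form 1 2 y (dual_basis 3 y).

Definition first_form (y X : 'rV[R]_3) : R :=
  2 * (coframe 2 y X * coframe 3 y X).

Definition second_form_tilde (y X : 'rV[R]_3) : R :=
  lambda22 y * coframe 2 y X ^+ 2
  + 2 * lambda23 y * (coframe 2 y X * coframe 3 y X)
  + lambda33 y * coframe 3 y X ^+ 2.

Definition second_form (y X : 'rV[R]_3) : R :=
  second_form_tilde y X - lambda23 y * first_form y X.

End Frames.

Definition totally_umbilical : Prop :=
  forall chi phi O A, first_order_frame chi phi A O ->
    forall y, O y -> forall X, second_form chi phi A y X = 0.

(* Da and Db are the fields of alpha- and beta-planes of V: near every point of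
   V there are first-order frames in which they are omega^3 = 0, omega^2 = 0. *)
Definition isotropic_distributions (Da Db : plane_field V) : Prop :=
  forall v : V, exists chi phi O A,
    [/\ first_order_frame chi phi A O, cdom chi v, O (cmap chi v) &
        forall y X, O y ->
          (Da chi y X <-> coframe chi phi A 3 y X = 0) /\
          (Db chi y X <-> coframe chi phi A 2 y X = 0)].

(** * Indefinite prolongation of the isotropic geodesics *)

(* The projective line is R with a point at infinity [None]; its two affine
   charts have inverses t |-> t and s |-> 1/s. *)
Definition affine_coord (k : bool) (t : R) : option R :=
  if k then (if t == 0 then None else Some t^-1) else Some t.

(* B x P^1 -> M in the coordinates (u_1, u_2, t). *)
Definition ruled_coord (B : manifold R 2) (f : B -> option R -> M)
    (psi : chart R 2 B) (k : bool) (z : 'rV[R]_3) : M :=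
  f (cinv psi (@lsubmx R 1 2 1 z)) (affine_coord k (z 0 ord_max)).

Definition ruled_dom (B : manifold R 2) (psi : chart R 2 B) : set 'rV[R]_3 :=
  [set z | cimg psi (@lsubmx R 1 2 1 z)].

(* gam is an isotropic geodesic on which the parameter is projective: along it
   the point A_0 can be normalized so that its second derivative vanishes, i.e.
   A_0(s) = A_0(0) + s A_1, with A_0(0) and A_1 parallel, develops onto the
   projective line A_0A_1. With x = gam(s), the vanishing of
   D^2(r E_0) amounts to (x', x') = 0, nabla_{x'} x' = - 2 (r'/r) x' and an
   equation r'' + r * normal_tensor(x', x') = 0 that fixes the projective parameter. *)
Definition projective_geodesic_at0 (phi : chart R 4 M) (gam : R -> 'rV[R]_4) :
    Prop :=
  'D_1 gam 0 != 0 /\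
  exists (r : R -> R) (W : set R),
    [/\ open W, W 0, smooth_on W r, forall s, W s -> r s != 0 &
        forall s, W s ->
          let D A := covariant_derivative (metric c phi) gam A 1 in
          D (D (fun s => r s *: base_point R)) s = 0].

(* V is swept out by (open parts of) isotropic geodesics which prolong to whole
   projective lines: there are a surface B and a smooth map f : B x P^1 -> M
   every generator {b} x P^1 of which is, in each affine coordinate, a
   projectively parametrized isotropic geodesic prolonging one of V, and V has
   charts (u_1, u_2, t) in which it is f and its isotropic geodesics are the
   t-lines. The map f may be singular outside of V. *)
Definition geodesics_prolongable : Prop :=
  exists (B : manifold R 2) (f : B -> option R -> M),
    let swept v chi psi k :=
      [/\ atlas chi, cdom chi v, atlas psi & forall z, cimg chi z ->
        [/\ ruled_dom psi z, iota (cinv chi z) = ruled_coord f psi k z &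
            forall phi, atlas phi -> cdom phi (iota (cinv chi z)) ->
              on_isotropic_line chi phi z (delta_mx 0 ord_max)]] in
    [/\ forall psi k, atlas psi ->
          smooth_into (ruled_dom psi) (ruled_coord f psi k),
        forall psi k phi z, atlas psi -> atlas phi -> ruled_dom psi z ->
          cdom phi (ruled_coord f psi k z) ->
          projective_geodesic_at0 phi (fun s : R =>
            cmap phi (ruled_coord f psi k (z + s *: delta_mx 0 ord_max))),
        forall v : V, exists chi psi k, swept v chi psi k &
        forall b : B, exists v chi psi k,
          swept v chi psi k /\
          cdom psi b /\ cmap psi b = @lsubmx R 1 2 1 (cmap chi v)].

End Hypersurface.

(* Main.v *)
Require Import Defs.
From mathcomp Require Import all_boot all_order all_algebra.
From mathcomp Require Import all_classical all_reals all_analysis.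
From mathcomp Require Import ring lra.

(** Let [omega^1, omega^2, omega^3] be the coframe of a first-order frame field
    of V. As [omega^4 = 0] on V and [omega_2^3 = omega_3^2 = 0], the structure
    equations of the torsion-free connection reduce to

      [d omega^3 = lambda_22 omega^1 /\ omega^2] modulo [omega^3],
      [d omega^2 = lambda_33 omega^1 /\ omega^3] modulo [omega^2],

    while [II = lambda_22 (omega^2)^2 + lambda_33 (omega^3)^2]. So the planes
    [omega^3 = 0] are integrable if and only if [lambda_22 = 0], the planes
    [omega^2 = 0] if and only if [lambda_33 = 0], and V is totally umbilical if
    and only if both coefficients vanish.

    The two congruences are the lemma [structure_equation]. It is proved for an
    isotropic frame along an arbitrary map into M, so that it applies to V and to
    the surfaces in V. Behind it are the symmetry of second derivatives, which
    is the absence of torsion, and the constancy of the scalar products of the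
    frame vectors.

    If the distributions are integrable, the frame is pulled back to an integral
    surface, on which one of the forms [omega^2], [omega^3] vanishes; the
    structure equation then kills one coefficient
    ([integral_surface_second_form]). Umbilicity has to be tested in every
    first-order frame, and exchanging [A_2] and [A_3] exchanges the two forms.
    What does not depend on the frame is the pair of planes
    [omega^2 omega^3 = 0], the null vectors of V ([null_planes]). Since the
    distributions are distinct, they account for both coefficients.

    Conversely, the prolongability of the isotropic geodesics provides charts
    [(u_1, u_2, t)] of V in which these geodesics are the t-lines. There
    [omega^k], up to a factor, is [a_0 du_1 + a_1 du_2], and the vanishing of the
    coefficient says that the Wronskian of [a_0] and [a_1] along the t-lines is
    zero ([plane_coeff_wronskian]): the ratio of [a_0] and [a_1] does not depend
    on t. An integral surface is therefore swept out by the t-lines through the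
    points of one integral curve of the field [(- a_1, a_0, 0)]
    ([integral_leaf]). In this way the theorem of Frobenius is reduced to the
    existence of integral curves, obtained by Picard iteration
    ([integral_curve]). *)

Set Implicit Arguments.
Unset Strict Implicit.
Unset Printing Implicit Defensive.
Import Order.TTheory GRing.Theory Num.Theory numFieldNormedType.Exports.
Local Open Scope classical_set_scope.
Local Open Scope ring_scope.

(** * Differential calculus *)

Section Differentiability.
Context {R : realType}.
Implicit Types E F : normedModType R.

Lemma near_eq_differentiable E F (f g : E -> F) (x : E) :
  (\near x, f x = g x) -> differentiable f x -> differentiable g x.
Proof.
move=> fg df; have dfc := diff_continuous df.
have e : g \o shift x = cst (g x) + 'd f x +o_ 0 id.
  apply/eqaddoP => _/posnumP[eps].
  have /eqaddoP/(_ eps%:num [gt0 of eps%:num]) := diff_locally df.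
  apply: filter_app.
  have : \forall h \near (0 : E), f (h + x) = g (h + x).
    by have := fg; rewrite (near_shift 0) subr0.
  apply: filterS => h /= fgh.
  by rewrite /= -!fctE /= !fctE /= fgh (nbhs_singleton fg).
have dgE := diff_unique dfc e.
apply/diff_locallyP; split; first by rewrite dgE.
by rewrite dgE.
Qed.

Lemma differentiable_mxP E m n (f : E -> 'M[R]_(m, n)) (x : E) :
  differentiable f x <-> forall i j, differentiable (fun y => f y i j) x.
Proof.
split=> [df i j|df].
  exact: (differentiable_comp df (differentiable_coord _ _ _)).
have -> : f = \sum_(i < m) \sum_(j < n) (fun y => f y i j *: delta_mx i j).
  apply/funext => y; rewrite [LHS]matrix_sum_delta fct_sumE.
  by apply: eq_bigr => i _; rewrite fct_sumE.
by do 2! apply: differentiable_sum => ?; exact: differentiableZl.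
Qed.

Lemma derive_mx_coord E m n (f : E -> 'M[R]_(m, n)) (x v : E) i j :
  differentiable f x -> 'D_v (fun y => f y i j) x = ('D_v f x) i j.
Proof. by move=> df; rewrite derive_mx ?mxE//; exact: diff_derivable. Qed.

Lemma derive_comp E m F (f : E -> 'rV[R]_m) (g : 'rV[R]_m -> F) (x v : E) :
  differentiable f x -> differentiable g (f x) ->
  'D_v (g \o f) x = 'D_('D_v f x) g (f x).
Proof.
move=> df dg; rewrite [LHS]deriveE; last exact: differentiable_comp.
by rewrite diff_comp//= -(deriveE _ df) -(deriveE _ dg).
Qed.

Lemma derive_linear_dir E F (f : E -> F) (x : E) :
  differentiable f x -> linear (fun v => 'D_v f x).
Proof. by move=> df a u v; rewrite !deriveE// linearP. Qed.

Lemma is_derive_line E F (f : E -> F) (x v : E) (s : R) :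
  differentiable f (x + s *: v) ->
  is_derive s 1 (fun t => f (x + t *: v)) ('D_v f (x + s *: v)).
Proof.
move=> df; have dl : differentiable (fun t : R => x + t *: v) s.
  by apply: differentiableD => //; exact: differentiableZl.
have dc : differentiable (fun t : R => f (x + t *: v)) s.
  exact: (@differentiable_comp _ _ _ _ (fun t : R => x + t *: v) f).
apply: DeriveDef; first exact: diff_derivable.
rewrite [LHS]deriveE// (@diff_comp _ _ _ _ (fun t : R => x + t *: v) f)//=.
rewrite deriveE//; congr ('d f _ _).
rewrite diffD; [|exact: differentiable_cst|exact: (@differentiableZl _ _ _ id v s)].
rewrite diff_cst/= add0r (@diffZl _ _ _ id v s)//.
by rewrite (_ : 'd id s 1 = 1) ?scale1r// diff_val.
Qed.

Lemma MVT_closed (f df : R -> R) (a b : R) : a < b ->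
  (forall x, a <= x <= b -> is_derive x 1 f (df x)) ->
  exists2 c, a < c < b & f b - f a = df c * (b - a).
Proof.
move=> ab fd; have [||c] := @MVT _ f df a b ab.
- by move=> x; rewrite in_itv/= => /andP[/ltW ax /ltW xb]; apply: fd; rewrite ax.
- apply: derivable_within_continuous => x; rewrite in_itv/= => /fd[].
  by [].
by rewrite in_itv/=; exists c.
Qed.

Lemma sum_funE E F n (h : 'I_n -> E -> F) :
  (fun x => \sum_i h i x) = \sum_i h i.
Proof. by apply/funext => x; rewrite fct_sumE. Qed.

Lemma differentiable_mulmx E m n p (f : E -> 'M[R]_(m, n)) (g : E -> 'M[R]_(n, p))
    (x : E) : differentiable f x -> differentiable g x ->
  differentiable (fun y => f y *m g y) x.
Proof.
move=> /differentiable_mxP df /differentiable_mxP dg.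
apply/differentiable_mxP => i j; under eq_fun do rewrite mxE.
by rewrite sum_funE; apply: differentiable_sum => k; exact: differentiableM.
Qed.

Lemma derive_mulmx E m n p (f : E -> 'M[R]_(m, n)) (g : E -> 'M[R]_(n, p))
    (x v : E) : differentiable f x -> differentiable g x ->
  'D_v (fun y => f y *m g y) x = 'D_v f x *m g x + f x *m 'D_v g x.
Proof.
move=> df dg; have dfg i j : differentiable (fun y => f y i j) x.
  by move/differentiable_mxP : df.
have dgg i j : differentiable (fun y => g y i j) x.
  by move/differentiable_mxP : dg.
apply/matrixP => i j; rewrite -derive_mx_coord; last exact: differentiable_mulmx.
rewrite !mxE; under eq_fun do rewrite mxE.
rewrite sum_funE derive_sum => [|k]; last first.
  by apply: diff_derivable; exact: differentiableM.
rewrite -big_split/=; apply: eq_bigr => k _.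
rewrite deriveM; [|exact: diff_derivable..].
by rewrite !derive_mx_coord// addrC; congr (_ + _); rewrite /GRing.scale/= mulrC.
Qed.

End Differentiability.

Section Smoothness.
Context {R : realType}.
Implicit Types E F : normedModType R.

Section Class.
Variables (E F : normedModType R) (U : set E).
(** Smoothness is a statement about all lists of directions; induction on the
    order of differentiability is what makes products and composites
    tractable. *)
Fixpoint Ck (k : nat) (f : E -> F) : Prop :=
  (forall x, U x -> differentiable f x) /\
  (if k is k'.+1 then forall v, Ck k' ('D_v f) else True).
End Class.

Lemma Ck_differentiable E F k (U : set E) (f : E -> F) x :
  Ck U k f -> U x -> differentiable f x.
Proof. by case: k => [|k] [df _]; apply: df. Qed.

Lemma smooth_onP E F (U : set E) (f : E -> F) :
  smooth_on U f <-> forall k, Ck U k f.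
Proof.
split=> [sf k|cf s].
  elim: k f sf => [|k IHk] f sf; (split; first exact: (sf [::])) => // v.
  by apply: IHk => s x Ux; have := sf (rcons s v) x Ux; rewrite foldr_rcons.
elim/last_ind: s f cf => [|s v IHs] f cf x Ux.
  exact: (Ck_differentiable (cf 0) Ux).
by rewrite foldr_rcons; apply: IHs Ux => k; have [_] := cf k.+1; apply.
Qed.

Lemma smooth_derive E F (U : set E) (f : E -> F) v :
  smooth_on U f -> smooth_on U ('D_v f).
Proof. by move=> sf s x Ux; have := sf (rcons s v) x Ux; rewrite foldr_rcons. Qed.

Lemma smooth_differentiable E F (U : set E) (f : E -> F) x :
  smooth_on U f -> U x -> differentiable f x.
Proof. by move=> sf; exact: (sf [::]). Qed.

Lemma smooth_sub E F (U U' : set E) (f : E -> F) :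
  U' `<=` U -> smooth_on U f -> smooth_on U' f.
Proof. by move=> U'U sf s x /U'U; exact: sf. Qed.

Lemma CkS E F k (U : set E) (f : E -> F) : Ck U k.+1 f -> Ck U k f.
Proof.
elim: k f => [|k IHk] f [df dDf]; split=> // v; exact/IHk/dDf.
Qed.

Lemma open_near_eq E F (U : set E) (f g : E -> F) : open U ->
  (forall x, U x -> f x = g x) -> forall x, U x -> \near x, f x = g x.
Proof.
move=> oU fg x Ux; have : nbhs x U by exact: open_nbhs_nbhs.
by apply: filterS => y; exact: fg.
Qed.

Lemma Ck_eq E F k (U : set E) (f g : E -> F) : open U ->
  (forall x, U x -> f x = g x) -> Ck U k f -> Ck U k g.
Proof.
move=> oU; elim: k f g => [|k IHk] f g fg [df dDf]; split => //.
- move=> x Ux; exact: near_eq_differentiable (open_near_eq oU fg Ux) (df x Ux).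
- move=> x Ux; exact: near_eq_differentiable (open_near_eq oU fg Ux) (df x Ux).
- move=> v; apply: IHk (dDf v) => x Ux.
  exact: near_eq_derive (open_near_eq oU fg Ux).
Qed.

Lemma Ck_cst E F k (U : set E) (a : F) : Ck U k (fun _ : E => a).
Proof.
elim: k a => [|k IHk] a;
  (split; first by move=> x _; exact: differentiable_cst) => // v.
have -> : 'D_v (fun _ : E => a) = fun _ => 0.
    by apply/funext => x; exact: derive_cst.
  exact: IHk.
Qed.

Lemma CkD E F k (U : set E) (f g : E -> F) : open U ->
  Ck U k f -> Ck U k g -> Ck U k (fun x => f x + g x).
Proof.
move=> oU; elim: k f g => [|k IHk] f g [df dDf] [dg dDg]; split => //.
- by move=> x Ux; apply: differentiableD; [exact: df|exact: dg].
- by move=> x Ux; apply: differentiableD; [exact: df|exact: dg].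
- move=> v; apply: Ck_eq (IHk _ _ (dDf v) (dDg v)) => // x Ux.
  by rewrite -deriveD//; apply: diff_derivable; [exact: df|exact: dg].
Qed.

Lemma Ck_sum E F k (U : set E) n (f : 'I_n -> E -> F) : open U ->
  (forall i, Ck U k (f i)) -> Ck U k (fun x => \sum_i f i x).
Proof.
move=> oU cf; elim: n f cf => [|n IHn] f cf.
  by under eq_fun do rewrite big_ord0; exact: Ck_cst.
by under eq_fun do rewrite big_ord_recl; apply: CkD => //; exact: IHn.
Qed.

Lemma CkM E k (U : set E) (f g : E -> R) : open U ->
  Ck U k f -> Ck U k g -> Ck U k (fun x => f x * g x).
Proof.
move=> oU; elim: k f g => [|k IHk] f g cf cg.
  split=> // x Ux; apply: differentiableM; first exact: Ck_differentiable cf Ux.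
  exact: Ck_differentiable cg Ux.
split=> [x Ux|v].
- apply: differentiableM; first exact: Ck_differentiable cf Ux.
  exact: Ck_differentiable cg Ux.
- move: (cf) (cg) => [df dDf] [dg dDg].
  apply: Ck_eq (CkD oU (IHk _ _ (CkS cf) (dDg v)) (IHk _ _ (CkS cg) (dDf v))) => //.
  move=> x Ux; rewrite [RHS]deriveM//; apply: diff_derivable; [exact: df|exact: dg].
Qed.

Lemma Ck_mxP E k (U : set E) m n (f : E -> 'M[R]_(m, n)) : open U ->
  Ck U k f <-> forall i j, Ck U k (fun x => f x i j).
Proof.
move=> oU; elim: k f => [|k IHk] f.
  split=> [[df _] i j|cf]; split=> // x Ux.
    by have /differentiable_mxP := df x Ux; apply.
  by apply/differentiable_mxP => i j; exact: Ck_differentiable (cf i j) Ux.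
split=> [[df dDf] i j|cf]; split=> [x Ux|v].
- by have /differentiable_mxP := df x Ux; apply.
- have /IHk/(_ i j) := dDf v; apply: Ck_eq => // x Ux.
  by rewrite -derive_mx_coord//; exact: df.
- by apply/differentiable_mxP => i j; exact: Ck_differentiable (cf i j) Ux.
- apply/IHk => i j; have [_ /(_ v)] := cf i j; apply: Ck_eq => // x Ux.
  rewrite derive_mx_coord//; apply/differentiable_mxP => i' j'.
  exact: Ck_differentiable (cf i' j') Ux.
Qed.

Lemma derive_sum_delta F m (g : 'rV[R]_m -> F) (x w : 'rV[R]_m) :
  differentiable g x -> 'D_w g x = \sum_j w 0 j *: 'D_(delta_mx 0 j) g x.
Proof.
move=> dg; rewrite deriveE// {1}(row_sum_delta w) linear_sum.
by apply: eq_bigr => j _; rewrite linearZ/= deriveE.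
Qed.

Lemma Ck_comp_real E m k (U : set E) (W : set 'rV[R]_m) (f : E -> 'rV[R]_m)
    (g : 'rV[R]_m -> R) : open U -> (forall x, U x -> W (f x)) ->
  Ck U k f -> Ck W k g -> Ck U k (g \o f).
Proof.
move=> oU fW; elim: k g => [|k IHk] g cf cg; split=> //.
- move=> x Ux; apply: differentiable_comp; first exact: Ck_differentiable cf Ux.
  exact: Ck_differentiable cg (fW x Ux).
- move=> x Ux; apply: differentiable_comp; first exact: Ck_differentiable cf Ux.
  exact: Ck_differentiable cg (fW x Ux).
- move=> v; have [dg dDg] := cg.
  have c1 : Ck U k (fun x => \sum_j ('D_v f x) 0 j * ('D_(delta_mx 0 j) g \o f) x).
    apply: Ck_sum => // j; apply: CkM => //.
      by case: cf => _ /(_ v) /(Ck_mxP _ _ oU); exact.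
    by apply: IHk (CkS cf) _; exact: dDg.
  apply: Ck_eq c1 => // x Ux; rewrite derive_comp; last exact/dg/fW.
    by rewrite derive_sum_delta//; exact/dg/fW.
  exact: Ck_differentiable cf Ux.
Qed.

Lemma smooth_mxP E (U : set E) m n (f : E -> 'M[R]_(m, n)) : open U ->
  smooth_on U f <-> forall i j, smooth_on U (fun x => f x i j).
Proof.
move=> oU; split=> [/smooth_onP sf i j|sf]; apply/smooth_onP => k.
  by have /(Ck_mxP _ _ oU) := sf k; apply.
by apply/(Ck_mxP _ _ oU) => i j; have /smooth_onP := sf i j; apply.
Qed.

Lemma Ck_comp E m k (U : set E) (W : set 'rV[R]_m) p q (f : E -> 'rV[R]_m)
    (g : 'rV[R]_m -> 'M[R]_(p, q)) : open U -> open W ->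
  (forall x, U x -> W (f x)) -> Ck U k f -> Ck W k g -> Ck U k (g \o f).
Proof.
move=> oU oW fW sf /(Ck_mxP _ _ oW) sg; apply/(Ck_mxP _ _ oU) => i j.
exact: Ck_comp_real oU fW sf (sg i j).
Qed.

Lemma smooth_comp E m (U : set E) (W : set 'rV[R]_m) p q (f : E -> 'rV[R]_m)
    (g : 'rV[R]_m -> 'M[R]_(p, q)) : open U -> open W ->
  (forall x, U x -> W (f x)) -> smooth_on U f -> smooth_on W g ->
  smooth_on U (g \o f).
Proof.
move=> oU oW fW /smooth_onP sf /smooth_onP sg; apply/smooth_onP => k.
exact: Ck_comp oU oW fW (sf k) (sg k).
Qed.

Lemma smooth_mulmx E (U : set E) m n p (f : E -> 'M[R]_(m, n))
    (g : E -> 'M[R]_(n, p)) : open U ->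
  smooth_on U f -> smooth_on U g -> smooth_on U (fun x => f x *m g x).
Proof.
move=> oU /(smooth_mxP _ oU) sf /(smooth_mxP _ oU) sg.
apply/(smooth_mxP _ oU) => i j; apply/smooth_onP => k.
under eq_fun do rewrite mxE; apply: Ck_sum => // l; apply: CkM => //.
  by have /smooth_onP := sf i l; apply.
by have /smooth_onP := sg l j; apply.
Qed.

(** Bootstrapping: if h is of class [C^k], so is [Phi v (h x)], which is its
    derivative; hence h is of class [C^(k+1)]. *)
Lemma smooth_ode E m (U : set E) (W : set 'rV[R]_m) (h : E -> 'rV[R]_m)
    (Phi : E -> 'rV[R]_m -> 'rV[R]_m) : open U -> open W ->
  (forall x, U x -> W (h x)) -> (forall x, U x -> differentiable h x) ->
  (forall v, smooth_on W (Phi v)) ->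
  (forall v x, U x -> 'D_v h x = Phi v (h x)) -> smooth_on U h.
Proof.
move=> oU oW hW dh sPhi hPhi; apply/smooth_onP => k.
elim: k => [|k IHk]; split=> // v.
have /smooth_onP/(_ k) c := sPhi v.
by apply: Ck_eq (Ck_comp oU oW hW IHk c) => // x Ux; rewrite hPhi.
Qed.

(** The mean value theorem, applied along u and then along v, turns the second
    difference over a parallelogram into a mixed derivative. The left-hand side
    is symmetric in u and v up to reordering, whence Schwarz's theorem. *)
Lemma second_difference E (U : set E) (f : E -> R) (u v x : E) (h : R) :
  smooth_on U f -> 0 < h ->
  (forall s t, 0 <= s <= h -> 0 <= t <= h -> U (x + s *: u + t *: v)) ->
  exists s t, [/\ 0 <= s <= h, 0 <= t <= h &
    f (x + h *: u + h *: v) - f (x + h *: u) - (f (x + h *: v) - f x)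
    = 'D_v ('D_u f) (x + s *: u + t *: v) * h * h].
Proof.
move=> sf h0 box; have hh : 0 <= h <= h by rewrite ltW/=.
have h00 : (0 : R) <= 0 <= h by rewrite lexx ltW.
have df y : U y -> differentiable f y by exact: smooth_differentiable.
pose phi s := f (x + s *: u + h *: v) - f (x + s *: u).
have [|s /andP[s0 sh]] := @MVT_closed R phi
  (fun s => 'D_u f (x + s *: u + h *: v) - 'D_u f (x + s *: u)) _ _ h0.
  move=> s sh; apply: is_deriveB.
    have := @is_derive_line _ _ _ f (x + h *: v) u s.
    rewrite addrAC; under eq_fun do rewrite addrAC.
    by apply; apply: df; exact: box.
  apply: is_derive_line; apply: df.
  by have := box s 0 sh h00; rewrite scale0r addr0.
have sh' : 0 <= s <= h by rewrite !ltW.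
rewrite /phi subr0 !scale0r !addr0 => ->.
have [|t /andP[t0 th]] := @MVT_closed R (fun t => 'D_u f (x + s *: u + t *: v))
  (fun t => 'D_v ('D_u f) (x + s *: u + t *: v)) _ _ h0.
  move=> t th; apply: is_derive_line.
  by apply: (smooth_differentiable (smooth_derive u sf)); exact: box.
rewrite scale0r addr0 subr0 => ->.
by exists s, t; rewrite sh' !ltW.
Qed.

(** The two mixed derivatives are continuous at x and, by [second_difference],
    take a common value, at two points of any small parallelogram at x. *)
Lemma derive_swap_real E (U : set E) (f : E -> R) (u v x : E) : open U ->
  smooth_on U f -> U x -> 'D_u ('D_v f) x = 'D_v ('D_u f) x.
Proof.
move=> oU sf Ux; apply/eqP/negPn/negP => ne.
set a := 'D_u _ x in ne; set b := 'D_v _ x in ne.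
(* values within e of a and of b cannot be equal *)
pose e := `|a - b| / 2; have e0 : 0 < e by rewrite divr_gt0// normr_gt0 subr_eq0.
have ca : {for x, continuous ('D_u ('D_v f))}.
  apply/differentiable_continuous.
  exact: smooth_differentiable (smooth_derive u (smooth_derive v sf)) Ux.
have cb : {for x, continuous ('D_v ('D_u f))}.
  apply/differentiable_continuous.
  exact: smooth_differentiable (smooth_derive v (smooth_derive u sf)) Ux.
have na : \forall y \near x, `|a - 'D_u ('D_v f) y| < e by move/cvgrPdist_lt : ca; apply.
have nb : \forall y \near x, `|b - 'D_v ('D_u f) y| < e by move/cvgrPdist_lt : cb; apply.
have nU : nbhs x U by exact: open_nbhs_nbhs.
have : nbhs x [set y | [/\ U y, `|a - 'D_u ('D_v f) y| < e &
                           `|b - 'D_v ('D_u f) y| < e]].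
  by apply: filterS3 nU na nb => y; split.
move=> /nbhs_ballP[d /= d0 dsub].
pose h := d / (`|u| + `|v| + 1).
have n0 : 0 < `|u| + `|v| + 1 by rewrite ltr_wpDl// addr_ge0.
have h0 : 0 < h by rewrite divr_gt0.
have box s t : 0 <= s <= h -> 0 <= t <= h -> ball x d (x + s *: u + t *: v).
  move=> /andP[s0 sh] /andP[t0 th]; rewrite -ball_normE/= -addrA opprD addNKr normrN.
  rewrite (le_lt_trans (ler_normD _ _))// !normrZ !ger0_norm//.
  have -> : d = h * (`|u| + `|v| + 1) by rewrite divfK// gt_eqF.
  rewrite !mulrDr mulr1 (@le_lt_trans _ _ (h * `|u| + h * `|v|))//.
    by rewrite lerD// ler_wpM2r.
  by rewrite ltrDl.
have [s [t [sh th E1]]] := second_difference sf h0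
  (fun s t hs ht => let: And3 p _ _ := dsub _ (box s t hs ht) in p).
have box' s' t' : 0 <= s' <= h -> 0 <= t' <= h -> ball x d (x + s' *: v + t' *: u).
  by move=> hs ht; rewrite addrAC; exact: box.
have [s' [t' [sh' th' E2]]] := second_difference sf h0
  (fun s t hs ht => let: And3 p _ _ := dsub _ (box' s t hs ht) in p).
have [_ _ Hb] := dsub _ (box s t sh th).
have [_ Ha _] := dsub _ (box' s' t' sh' th').
have : 'D_v ('D_u f) (x + s *: u + t *: v) = 'D_u ('D_v f) (x + s' *: v + t' *: u).
  have sec (A B p q r t0 : R) : p - q - (r - t0) = A * h * h ->
      p - r - (q - t0) = B * h * h -> A = B.
    have hn : h != 0 by rewrite gt_eqF.
    move=> eA eB; apply: (mulIf hn); apply: (mulIf hn); rewrite -eA -eB.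
    by ring.
  rewrite (addrAC x (h *: v)) in E2; exact: sec E1 E2.
move=> E3; rewrite E3 in Hb.
have : `|a - b| < e + e.
  move: Ha Hb; move: ('D_u ('D_v f) _) => z; clearbody a b => Ha Hb.
  by apply: le_lt_trans (ler_distD z a b) _; rewrite distrC in Hb; exact: ltrD.
by rewrite /e -splitr ltxx.
Qed.

Lemma derive_swap E (U : set E) m n (f : E -> 'M[R]_(m, n)) (u v x : E) :
  open U -> smooth_on U f -> U x -> 'D_u ('D_v f) x = 'D_v ('D_u f) x.
Proof.
move=> oU sf Ux; apply/matrixP => i j.
have H w w' : ('D_w ('D_w' f) x) i j = 'D_w ('D_w' (fun y => f y i j)) x.
  rewrite -derive_mx_coord; last exact: smooth_differentiable (smooth_derive _ sf) Ux.
  apply: near_eq_derive; apply: (open_near_eq oU) Ux => y Uy.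
  by rewrite derive_mx_coord//; exact: smooth_differentiable sf Uy.
have sij : smooth_on U (fun y => f y i j) by move/(smooth_mxP _ oU) : sf; apply.
exact: etrans (H u v) (etrans (derive_swap_real u v oU sij Ux) (esym (H v u))).
Qed.

Lemma smoothD (E F : normedModType R) (U : set E) (f g : E -> F) : open U ->
  smooth_on U f -> smooth_on U g -> smooth_on U (fun x => f x + g x).
Proof.
move=> oU /smooth_onP sf /smooth_onP sg; apply/smooth_onP => k.
exact: CkD oU (sf k) (sg k).
Qed.

Lemma smoothMl (E : normedModType R) (U : set E) (a : R) (f : E -> R) : open U ->
  smooth_on U f -> smooth_on U (fun x => a * f x).
Proof.
move=> oU /smooth_onP sf; apply/smooth_onP => k.
exact: CkM oU (Ck_cst _ _ _) (sf k).
Qed.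

Lemma smoothZ (E : normedModType R) (U : set E) m n (a : R) (f : E -> 'M[R]_(m, n)) :
  open U -> smooth_on U f -> smooth_on U (fun x => a *: f x).
Proof.
move=> oU /(smooth_mxP _ oU) sf; apply/(smooth_mxP _ oU) => i j.
by under eq_fun do rewrite mxE; exact: smoothMl.
Qed.

Lemma derive_coord n (u v : 'rV[R]_n) i : 'D_v (fun x : 'rV[R]_n => x 0 i) u = v 0 i.
Proof. by rewrite (@derive_mx_coord _ _ _ _ id)// derive_id. Qed.

Lemma smooth_coord n (U : set 'rV[R]_n) i : smooth_on U (fun x => x 0 i).
Proof.
apply/smooth_onP => -[|k];
  (split; first by move=> x _; exact: differentiable_coord) => // v.
have -> : 'D_v (fun x : 'rV[R]_n => x 0 i) = fun _ => v 0 i.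
  by apply/funext => u; exact: derive_coord.
exact: Ck_cst.
Qed.

(** A curve, seen as a map that depends on one coordinate. *)
Lemma derive_row_curve n m (g : R -> 'rV[R]_m) (i : 'I_n) (u v : 'rV[R]_n) :
  differentiable g (u 0 i) ->
  differentiable (fun x : 'rV[R]_n => g (x 0 i)) u /\
  'D_v (fun x : 'rV[R]_n => g (x 0 i)) u = v 0 i *: 'D_1 g (u 0 i).
Proof.
move=> dg; have dc : differentiable (fun x : 'rV[R]_n => x 0 i) u.
  exact: differentiable_coord.
have dgc := differentiable_comp dc dg; split => //.
apply: etrans (deriveE _ dgc) _; rewrite diff_comp//=.
rewrite -(deriveE _ dc) derive_coord deriveE// -linearZ/=.
by rewrite [X in _ = 'd g _ X]mulr1.
Qed.

End Smoothness.

Lemma derive_cst_on (R : realType) (E F : normedModType R) (U : set E) (f : E -> F)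
  (c : F) (x v : E) : open U -> (forall y, U y -> f y = c) -> U x -> 'D_v f x = 0.
Proof.
move=> oU fc Ux; transitivity ('D_v (cst c) x); last exact: derive_cst.
exact: near_eq_derive (open_near_eq oU fc Ux).
Qed.

Lemma open_preimage_on (E F : topologicalType) (U : set E) (W : set F) (f : E -> F) :
  open U -> (forall x, U x -> {for x, continuous f}) -> open W ->
  open (U `&` f @^-1` W).
Proof.
move=> oU cf oW; rewrite openE => x [Ux Wfx]; apply: filterI.
  exact: open_nbhs_nbhs.
by apply: (cf x Ux); exact: open_nbhs_nbhs.
Qed.

Lemma jacobian_comp (R : realType) m n l (f : 'rV[R]_m -> 'rV[R]_n)
    (g : 'rV[R]_n -> 'rV[R]_l) x :
  differentiable f x -> differentiable g (f x) ->
  'J (g \o f) x = 'J f x *m 'J g (f x).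
Proof.
move=> df dg; have dgf : differentiable (g \o f) x by exact: differentiable_comp.
apply/row_matrixP => i; rewrite !rowE mulmxA.
apply: etrans (esym (deriveEjacobian _ dgf)) _.
apply: etrans (derive_comp _ df dg) _; apply: etrans (deriveEjacobian _ dg) _.
by congr (_ *m _); exact: deriveEjacobian.
Qed.

(** The derivative of f / g is zero. *)
Lemma proportional_of_wronskian (R : realType) (f g df dg : R -> R) :
  (forall s : R, 0 <= s <= 1 -> is_derive s 1 f (df s)) ->
  (forall s : R, 0 <= s <= 1 -> is_derive s 1 g (dg s)) ->
  (forall s, 0 <= s <= 1 -> df s * g s = f s * dg s) ->
  (forall s, 0 <= s <= 1 -> g s != 0) -> f 1 * g 0 = g 1 * f 0.
Proof.
move=> fd gd w g0.
have [|c /andP[c0 c1]] := @MVT_closed R (fun s => f s / g s)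
    (fun s => f s * (- (g s) ^- 2 * dg s) + (g s)^-1 * df s) 0 1 ltr01.
  move=> s s01; have gs := g0 s s01; have fs := fd s s01; have gds := gd s s01.
  exact: is_deriveM.
have c01 : 0 <= c <= 1 by rewrite !ltW.
have -> : f c * (- g c ^- 2 * dg c) + (g c)^-1 * df c = 0.
  have gc := g0 c c01; have : df c = f c * dg c / g c by rewrite -w// mulfK.
  by move=> ->; field.
rewrite mul0r => /eqP; rewrite subr_eq0 eqr_div ?g0 ?lexx ?ler01// => /eqP ->.
by rewrite mulrC.
Qed.

(** * Integral curves of vector fields *)

Section ODE.
Context {R : realType}.

Lemma antiderivative (f : R -> R) (b : R) : 0 < b -> continuous f ->
  exists2 F : R -> R, F 0 = 0 & forall x : R, `|x| < b -> is_derive x 1 F (f x).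
Proof.
(* integrating from - b makes 0 an interior point *)
move=> b0 cf; pose G x := (\int[lebesgue_measure]_(t in `[- b, x]) f t)%R.
exists (fun x => G x - G 0) => [|x]; first by rewrite subrr.
rewrite ltr_norml => /andP[bx xb].
have intf : lebesgue_measure.-integrable `[- b, b] (EFin \o f).
  apply: continuous_compact_integrable; first exact: segment_compact.
  exact: continuous_subspaceT.
have [dG G'] := continuous_FTC1_closed xb intf bx (cf x).
have iG : is_derive x 1 G (f x).
  by apply: DeriveDef; [exact: dG|rewrite -derive1E].
by rewrite -[f x]subr0; apply: is_deriveB.
Qed.

Lemma mx_norm_le m n (A : 'M[R]_(m, n)) c : 0 <= c ->
  (forall i j, `|A i j| <= c) -> `|A| <= c.
Proof.
by move=> c0 h; rewrite [leLHS]/Num.Def.normr/= mx_normrE bigmax_le.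
Qed.

Lemma entry_le_mx_norm m n (A : 'M[R]_(m, n)) i j : `|A i j| <= `|A|.
Proof.
rewrite [leRHS]/Num.Def.normr/= mx_normrE.
exact: (le_bigmax _ (fun ij : 'I_m * 'I_n => `|A ij.1 ij.2|) (i, j)).
Qed.

Lemma ball_segment (E : normedModType R) (z x y : E) (r s : R) :
  ball z r x -> ball z r y -> 0 <= s <= 1 -> ball z r (y + s *: (x - y)).
Proof.
rewrite -ball_normE/= => zx zy /andP[s0 s1].
have -> : z - (y + s *: (x - y)) = s *: (z - x) + (1 - s) *: (z - y).
  rewrite scalerBl scale1r addrCA -scalerBr opprB [z - x + _]addrC subrKA.
  by rewrite opprD addrA -scalerN opprB.
apply: le_lt_trans (ler_normD _ _) _; rewrite !normrZ !ger0_norm ?subr_ge0//.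
move: zx zy; move: `|z - x| `|z - y| => a b ar br.
have [->|sn] := eqVneq s 0; first by rewrite mul0r add0r subr0 mul1r.
have s_gt0 : 0 < s by rewrite lt_def sn.
have -> : r = s * r + (1 - s) * r by ring.
by apply: ltr_leD; [rewrite ltr_pM2l|apply: ler_wpM2l; [rewrite subr_ge0|exact: ltW]].
Qed.

(** The partial derivatives are bounded near z0; the mean value theorem on the
    segment between two points of a ball makes a Lipschitz constant of the
    bound. *)
Lemma smooth_lipschitz m n (U : set 'rV[R]_m) (W : 'rV[R]_m -> 'rV[R]_n)
    (z0 : 'rV[R]_m) : open U -> smooth_on U W -> U z0 ->
  exists r L K : R, [/\ 0 < r, 0 <= L, 0 <= K & forall z, ball z0 r z ->
    [/\ U z, `|W z| <= K & forall z', ball z0 r z' -> `|W z - W z'| <= L * `|z - z'|]].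
Proof.
move=> oU sW Uz0.
pose d (p : 'I_n * 'I_m) := 'D_(delta_mx 0 p.2) (fun z => W z 0 p.1).
have sWi i : smooth_on U (fun z => W z 0 i) by move/(smooth_mxP _ oU) : sW; apply.
have nd : \forall z \near z0, forall p, `|d p z| <= `|d p z0| + 1.
  apply: (@filter_forall _ _ (fun p z => `|d p z| <= `|d p z0| + 1) (nbhs z0)) => p.
  have cd : {for z0, continuous (d p)}.
    apply/differentiable_continuous.
    exact: smooth_differentiable (smooth_derive _ (sWi _)) Uz0.
  move/cvgrPdist_lt : cd => /(_ 1 ltr01); apply: filterS => z /ltW le1.
  by rewrite -lerBlDl; apply: le_trans le1; rewrite distrC; exact: lerB_dist.
have nW : \forall z \near z0, `|W z| <= `|W z0| + 1.
  have cW : {for z0, continuous W}.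
    by apply/differentiable_continuous; exact: smooth_differentiable sW Uz0.
  move/cvgrPdist_lt : cW => /(_ 1 ltr01); apply: filterS => z /ltW le1.
  by rewrite -lerBlDl; apply: le_trans le1; rewrite distrC; exact: lerB_dist.
have nU : nbhs z0 U by exact: open_nbhs_nbhs.
have /nbhs_ballP[r /= r0 rsub] : nbhs z0 [set z | [/\ U z, `|W z| <= `|W z0| + 1 &
    forall p, `|d p z| <= `|d p z0| + 1]].
  by apply: filterS3 nU nW nd => z; split.
pose L := \sum_p (`|d p z0| + 1).
have L0 : 0 <= L by apply: sumr_ge0 => p _; exact: addr_ge0.
exists r, L, (`|W z0| + 1); split => // z bz.
have [Uz Wz _] := rsub _ bz; split => // z' bz'.
apply: mx_norm_le => [|i j]; first exact: mulr_ge0.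
rewrite ord1 !mxE => {i}.
pose g s := W (z' + s *: (z - z')) 0 j.
have [|s /andP[s0 s1]] := @MVT_closed R g
    (fun s => 'D_(z - z') (fun z => W z 0 j) (z' + s *: (z - z'))) _ _ ltr01.
  move=> s s01; apply: is_derive_line; apply: smooth_differentiable (sWi j) _.
  by have [] := rsub _ (ball_segment bz bz' s01).
rewrite /g scale1r scale0r addr0 (addrC z') subrK subr0 mulr1 => ->.
have [|Us _ ds] := rsub _ (ball_segment bz bz' (s := s) _); first by rewrite !ltW.
rewrite derive_sum_delta; last exact: smooth_differentiable (sWi j) Us.
apply: le_trans (ler_norm_sum _ _ _) _.
apply: (@le_trans _ _ (\sum_k (`|d (j, k) z0| + 1) * `|z - z'|)).
  apply: ler_sum => k _; rewrite normrZ mulrC; apply: ler_pM => //.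
    exact: (ds (j, k)).
  exact: entry_le_mx_norm.
rewrite -mulr_suml; apply: ler_wpM2r => //.
rewrite /L -(pair_bigA _ (fun i k => `|d (i, k) z0| + 1))/= (bigD1 j)//= lerDl.
by apply: sumr_ge0 => i _; apply: sumr_ge0 => k _; exact: addr_ge0.
Qed.

Lemma limit_norm_le (E : normedModType R) (u : E^nat) (l a : E) (c : R) (N : nat) :
  u @ \oo --> l -> (forall n, (N <= n)%N -> `|u n - a| <= c) -> `|l - a| <= c.
Proof.
move=> ul h; apply/ler_addgt0Pr => e e0.
move/cvgrPdist_lt : ul => /(_ e e0)[N' _ hN'].
have n1 := hN' (maxn N N') (leq_maxr _ _).
have n2 := h (maxn N N') (leq_maxl _ _).
by apply: le_trans (ler_distD (u (maxn N N')) l a) _; rewrite addrC lerD// ltW.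
Qed.

Lemma half_power_small (c e : R) : 0 < e -> exists n : nat, c * 2^-1 ^+ n < e.
Proof.
move=> e0; exists (Num.bound (c / e)); rewrite exprVn ltr_pdivrMr ?exprn_gt0//.
by rewrite mulrC -ltr_pdivrMr//; exact: upper_nthrootP.
Qed.

(** The tails are those of a geometric series, so that the sequence is Cauchy;
    the rate of convergence is what lets a contraction pass to the limit. *)
Lemma geometric_cvg n (u : ('rV[R]_n)^nat) (c : R) : 0 <= c ->
  (forall k, `|u k.+1 - u k| <= c * 2^-1 ^+ k) ->
  exists2 l : 'rV[R]_n, u @ \oo --> l & forall k, `|l - u k| <= 2 * c * 2^-1 ^+ k.
Proof.
move=> c0 step.
(* the factor 1 - 2^-j makes the induction on j go through *)
have tail N j : `|u (N + j)%N - u N| <= 2 * c * 2^-1 ^+ N * (1 - 2^-1 ^+ j).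
  elim: j => [|j IHj]; first by rewrite addn0 expr0 !subrr normr0 mulr0.
  apply: le_trans (ler_distD (u (N + j)%N) _ _) _.
  apply: le_trans (lerD (_ : _ <= c * 2^-1 ^+ (N + j)) IHj) _.
    by rewrite addnS; exact: step.
  rewrite exprD exprS [leLHS](_ : _ = 2 * c * 2^-1 ^+ N * (1 - 2^-1 * 2^-1 ^+ j))//.
  by field.
have tail' N k : (N <= k)%N -> `|u k - u N| <= 2 * c * 2^-1 ^+ N.
  move=> Nk; rewrite -(subnKC Nk); apply: le_trans (tail _ _) _.
  apply: ler_piMr; first by rewrite !mulr_ge0 ?exprn_ge0 ?invr_ge0.
  by rewrite lerBlDr lerDl exprn_ge0 ?invr_ge0.
have cu : cvg (u @ \oo).
  apply: cauchy_cvg; apply: cauchy_exP => e e0.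
  have [N hN] := half_power_small (2 * c) e0.
  exists (u N); exists N => // k /= Nk; rewrite -ball_normE/= distrC.
  exact: le_lt_trans (tail' _ _ Nk) hN.
exists (lim (u @ \oo)) => // k; apply: limit_norm_le cu _ => j; exact: tail'.
Qed.

Lemma MVT_norm_le (f df : R -> R) (a K s t : R) :
  (forall x : R, `|x| <= a -> is_derive x 1 f (df x)) ->
  (forall x, `|x| <= a -> `|df x| <= K) -> `|s| <= a -> `|t| <= a ->
  `|f s - f t| <= K * `|s - t|.
Proof.
move=> fd dfK; wlog st : s t / s <= t => [hw sa ta|sa ta].
  by have [/hw|/ltW/hw] := leP s t; [|rewrite distrC (distrC s)]; apply.
have [->|ne] := eqVneq s t; first by rewrite !subrr normr0 mulr0.
have lt : s < t by rewrite lt_def eq_sym ne.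
have inside x : s <= x <= t -> `|x| <= a.
  move: sa ta; rewrite !ler_norml => /andP[s1 s2] /andP[t1 t2] /andP[x1 x2].
  by rewrite (le_trans s1)//= (le_trans x2).
have [|c /andP[c1 c2] e] := @MVT_closed R f df s t lt.
  by move=> x /inside; exact: fd.
rewrite distrC e normrM (distrC s); apply: ler_wpM2r => //.
by apply/dfK/inside; rewrite !ltW.
Qed.

(** Precomposition with this retraction onto the interval [[- a, a]] makes the
    Picard iterates curves on the whole line, where the sup norm can be
    controlled without restricting domains. *)
Definition clamp (a s : R) : R := Num.max (- a) (Num.min a s).

Lemma clamp_le a s : 0 <= a -> `|clamp a s| <= a.
Proof.
move=> a0; rewrite /clamp ler_norml le_max lexx/= ge_max ge_min lexx/= andbT.
by rewrite ge0_cp.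
Qed.

Lemma clamp_id a s : `|s| <= a -> clamp a s = s.
Proof. by rewrite ler_norml => /andP[h1 h2]; rewrite /clamp min_r// max_r. Qed.

Lemma clamp_lipschitz a s t : `|clamp a s - clamp a t| <= `|s - t|.
Proof.
have h1 := ler_norm (s - t); have := ler_norm (t - s); rewrite distrC => h2.
have hmin : `|Num.min a s - Num.min a t| <= `|s - t|.
  rewrite ler_norml; apply/andP; rewrite /Num.min.
  by case: (ltP a s) => ?; case: (ltP a t) => ?; split; lra.
apply: le_trans hmin; rewrite /clamp; move: (Num.min a s) (Num.min a t) => x y.
have h3 := ler_norm (x - y); have := ler_norm (y - x); rewrite distrC => h4.
rewrite ler_norml; apply/andP; rewrite /Num.max.
by case: (ltP (- a) x) => ?; case: (ltP (- a) y) => ?; split; lra.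
Qed.

(** Picard iteration among the K-Lipschitz curves that stay within r / 2 of z0,
    for a time a so short that [K * a <= r / 2], which keeps the iterates in this
    class, and [L * a <= 1 / 2], which makes the iteration halve distances. *)
Theorem integral_curve m (U : set 'rV[R]_m) (W : 'rV[R]_m -> 'rV[R]_m)
    (z0 : 'rV[R]_m) : open U -> smooth_on U W -> U z0 ->
  exists (gam : R -> 'rV[R]_m) (del : R), [/\ 0 < del, gam 0 = z0 &
    forall s : R, `|s| < del ->
      [/\ U (gam s), differentiable gam s & 'D_1 gam s = W (gam s)]].
Proof.
move=> oU sW Uz0.
have [r [L [K [r0 L0 K0 hW]]]] := smooth_lipschitz oU sW Uz0.
(* at most r / (2 K) and 1 / (2 L); the summand 1 is for K = L = 0 *)
pose a := (K * 2 / r + L * 2 + 1)^-1.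
have den0 : 0 < K * 2 / r + L * 2 + 1.
  by rewrite ltr_wpDl// addr_ge0// ?divr_ge0 ?mulr_ge0// ltW.
have a0 : 0 < a by rewrite invr_gt0.
have aden : a * (K * 2 / r + L * 2 + 1) = 1 by rewrite mulVf// gt_eqF.
have pa p q : 0 <= p -> 0 <= q -> a * (p + q + 1) = 1 -> p * a <= 1.
  move=> p0 q0; rewrite !mulrDr mulr1 (mulrC p) => e.
  by have := mulr_ge0 (ltW a0) q0; lra.
have p0 : 0 <= K * 2 / r by rewrite divr_ge0 ?mulr_ge0// ltW.
have q0 : 0 <= L * 2 by rewrite mulr_ge0.
have aK : K * a <= r / 2.
  have := pa _ _ p0 q0 aden; rewrite [_ / r * a]mulrAC ler_pdivrMr// mul1r => h.
  by rewrite ler_pdivlMr// mulrAC.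
have aL : L * a <= 2^-1.
  have := pa _ _ q0 p0; rewrite (addrC (L * 2)) => /(_ aden) h.
  by rewrite -[2^-1]mul1r ler_pdivlMr// mulrAC.
pose admissible (Z : R -> 'rV[R]_m) := (forall s, `|Z s - z0| <= r / 2) /\
  (forall s t, `|Z s - Z t| <= K * `|s - t|).
have inball Z s : admissible Z -> ball z0 r (Z s).
  move=> [h _]; rewrite -ball_normE/= distrC.
  by apply: le_lt_trans (h s) _; rewrite ltr_pdivrMr// ltr_pMr// ltr1n.
(* P Z is z0 + int_0^s W (Z t) dt for |s| < a + 1, integrated by coordinates *)
have /choice[P hP] Z : exists Y : R -> 'rV[R]_m, admissible Z ->
    Y 0 = z0 /\ forall s : R, `|s| < a + 1 -> forall i,
      is_derive s 1 (fun s => Y s 0 i) (W (Z s) 0 i).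
  have [aZ|] := pselect (admissible Z); last first.
    by move=> nZ; exists Z.
  have cf i : continuous (fun s => W (Z s) 0 i).
    move=> s; apply/cvgrPdist_lt => e e0.
    have LK0 : 0 < L * K + 1 by rewrite ltr_wpDl// mulr_ge0.
    near=> t.
    have [_ _ /(_ _ (inball _ t aZ)) hst] := hW _ (inball _ s aZ).
    have := entry_le_mx_norm (W (Z s) - W (Z t)) 0 i; rewrite !mxE => h1.
    apply: le_lt_trans (le_trans h1 hst) _.
    apply: (@le_lt_trans _ _ (L * (K * `|s - t|))).
      by apply: ler_wpM2l => //; case: aZ => _; exact.
    rewrite mulrA; apply: (@le_lt_trans _ _ ((L * K + 1) * `|s - t|)).
      by apply: ler_wpM2r => //; rewrite lerDl.
    rewrite mulrC -ltr_pdivlMr//; near: t.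
    by apply/nbhs_ballP; exists (e / (L * K + 1)) => //=; exact: divr_gt0.
  have a10 : 0 < a + 1 by exact: addr_gt0.
  have /choice[F hF] i : exists F : R -> R, F 0 = 0 /\
      forall s : R, `|s| < a + 1 -> is_derive s 1 F (W (Z s) 0 i).
    have [F F0 dF] := antiderivative a10 (cf i).
    by exists F.
  exists (fun s => \row_i (z0 0 i + F i s)) => _; split.
    by apply/rowP => i; rewrite mxE (hF i).1 addr0.
  move=> s sa i; under eq_fun do rewrite mxE.
  rewrite -[W _ _ _]add0r; apply: is_deriveD; exact: (hF i).2.
have le_a1 x : `|x| <= a -> `|x| < a + 1 by move=> h; rewrite (le_lt_trans h)// ltrDl.
pose T Z s := P Z (clamp a s).
have admT Z : admissible Z -> admissible (T Z).
  move=> aZ; have [P0 dP] := hP Z aZ.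
  have lip s t : `|s| <= a -> `|t| <= a -> `|P Z s - P Z t| <= K * `|s - t|.
    move=> sa ta; apply: mx_norm_le => [|i j]; first exact: mulr_ge0.
    rewrite ord1 !mxE.
    apply: (@MVT_norm_le (fun s => P Z s 0 j) (fun s => W (Z s) 0 j) a) => // x /le_a1 xa.
      exact: dP.
    apply: le_trans (entry_le_mx_norm _ _ _) _; by have [] := hW _ (inball _ x aZ).
  have ca s : `|clamp a s| <= a by apply: clamp_le; exact: ltW.
  split=> [s|s t]; rewrite /T.
    rewrite -P0; apply: le_trans (lip _ _ (ca s) _) _; first by rewrite normr0 ltW.
    by rewrite subr0; apply: le_trans aK; apply: ler_wpM2l.
  apply: le_trans (lip _ _ (ca s) (ca t)) _; apply: ler_wpM2l => //.
  exact: clamp_lipschitz.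
have contr Z Z' c : admissible Z -> admissible Z' -> 0 <= c ->
    (forall s, `|Z s - Z' s| <= c) -> forall s, `|T Z s - T Z' s| <= c / 2.
  move=> aZ aZ' c0 hc s; have [P0 dP] := hP Z aZ; have [P0' dP'] := hP Z' aZ'.
  have ca : `|clamp a s| <= a by apply: clamp_le; exact: ltW.
  apply: mx_norm_le => [|i j]; first exact: divr_ge0.
  rewrite ord1 !mxE /T.
  have := @MVT_norm_le (fun s => P Z s 0 j - P Z' s 0 j)
    (fun s => W (Z s) 0 j - W (Z' s) 0 j) a (L * c) (clamp a s) 0.
  rewrite P0 P0' subrr !subr0 normr0 => /(_ _ _ ca (ltW a0)) h.
  apply: le_trans (h _ _) _ => [x /le_a1 xa|x xa|].
  - by apply: is_deriveB; [exact: dP|exact: dP'].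
  - have := entry_le_mx_norm (W (Z x) - W (Z' x)) 0 j; rewrite !mxE => /le_trans; apply.
    have [_ _ /(_ _ (inball _ x aZ')) hst] := hW _ (inball _ x aZ).
    by apply: le_trans hst _; exact: ler_wpM2l.
  - apply: (@le_trans _ _ (L * c * a)); first by apply: ler_wpM2l => //; exact: mulr_ge0.
    by rewrite mulrAC mulrC; exact: ler_wpM2l.
pose Z n := iter n T (fun _ => z0).
have aZ n : admissible (Z n).
  elim: n => [|n IHn]; last exact: admT.
  by split=> [s|s t] /=; rewrite subrr normr0 ?mulr_ge0 ?divr_ge0// ltW.
have stepZ n s : `|Z n.+1 s - Z n s| <= r * 2^-1 ^+ n.
  elim: n s => [|n IHn] s.
    rewrite expr0 mulr1; apply: le_trans ((aZ 1).1 s) _.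
    by rewrite ler_pdivrMr// ler_peMr// ?ltW// ltr1n.
  rewrite exprSr mulrA; apply: (contr (Z n.+1) (Z n)) => //.
  by rewrite mulr_ge0 ?exprn_ge0 ?invr_ge0// ltW.
have /choice[l hl] s : exists l : 'rV[R]_m, (Z n s @[n --> \oo] --> l) /\
    forall k, `|l - Z k s| <= 2 * r * 2^-1 ^+ k.
  have [l h1 h2] := @geometric_cvg _ (fun n => Z n s) r (ltW r0) (fun k => stepZ k s).
  by exists l.
have al : admissible l.
  split=> [s|s t].
    by apply: (limit_norm_le (hl s).1 (N := 0%N)) => n _; exact: (aZ n).1.
  rewrite -[l s - _]subr0.
  apply: (@limit_norm_le _ (fun n => Z n s - Z n t) _ _ _ 0%N) => [|n _].
    by apply: cvgB; [exact: (hl s).1|exact: (hl t).1].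
  by rewrite subr0; exact: (aZ n).2.
have fixed s : T l s = l s.
  apply/eqP; rewrite -subr_eq0 -normr_eq0 eq_le normr_ge0 andbT.
  apply/ler_addgt0Pr => e e0; rewrite add0r.
  have [n hn] := half_power_small (2 * r) e0; apply/ltW; apply: le_lt_trans hn.
  apply: le_trans (ler_distD (Z n.+1 s) _ _) _.
  have pn : 0 <= 2 * r * 2^-1 ^+ n.
    by rewrite !mulr_ge0 ?exprn_ge0 ?invr_ge0// ltW.
  have h1 := contr l (Z n) _ al (aZ n) pn (fun s => (hl s).2 n) s.
  have h2 : `|Z n.+1 s - l s| <= 2 * r * 2^-1 ^+ n / 2.
    by rewrite distrC; apply: le_trans ((hl s).2 n.+1) _; rewrite exprSr mulrA.
  by apply: le_trans (lerD h1 h2) _; rewrite -splitr.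
have [P0 dP] := hP l al.
exists (P l), a; split => // s sa.
have ls : l s = P l s by rewrite -fixed /T clamp_id// ltW.
have dPs i : is_derive s 1 (fun s => P l s 0 i) (W (l s) 0 i).
  by apply: dP; exact: le_a1 (ltW sa).
have dfl : differentiable (P l) s.
  apply/differentiable_mxP => i j; rewrite ord1.
  by apply/derivable1_diffP; have [] := dPs j.
split => //; first by rewrite -ls; have [] := hW _ (inball _ s al).
rewrite -ls; apply/rowP => i; rewrite -derive_mx_coord//.
by have [] := dPs i.
Unshelve. all: by end_near. Qed.

End ODE.

(** * Linear forms *)

Lemma linear_form0 (R : realType) (E : lmodType R) (f : E -> R) :
  (forall a X Y, f (a *: X + Y) = a * f X + f Y) -> f 0 = 0.
Proof.
move=> lf; have /eqP := lf 1 0 0.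
by rewrite scaler0 addr0 mul1r -subr_eq subrr eq_sym => /eqP.
Qed.

Lemma linear_row_sum (R : realType) n (f : 'rV[R]_n -> R) :
  (forall a X Y, f (a *: X + Y) = a * f X + f Y) ->
  forall X, f X = \sum_a X 0 a * f (delta_mx 0 a).
Proof.
move=> lin X; rewrite [in LHS](row_sum_delta X).
elim/big_rec2: _ => [|a y1 y2 _ <-]; last by rewrite lin.
exact: linear_form0 lin.
Qed.

(** A vector space is not the union of two proper subspaces. *)
Lemma linear_forms_product (R : realType) (E : lmodType R) (f g : E -> R) Z1 :
  (forall a X Y, f (a *: X + Y) = a * f X + f Y) ->
  (forall a X Y, g (a *: X + Y) = a * g X + g Y) ->
  (forall Z, f Z * g Z = 0) -> f Z1 != 0 -> forall Z, g Z = 0.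
Proof.
move=> lf lg fg f1 Z; have g1 : g Z1 = 0.
  by move/eqP : (fg Z1); rewrite mulf_eq0 (negbTE f1) => /eqP.
apply/eqP/negPn/negP => gZ; have fZ : f Z = 0.
  by move/eqP : (fg Z); rewrite mulf_eq0 (negbTE gZ) orbF => /eqP.
have := fg (1 *: Z1 + Z); rewrite lf lg g1 fZ addr0 mulr0 add0r mul1r => /eqP.
by rewrite mulf_eq0 (negbTE f1) (negbTE gZ).
Qed.

Lemma linear_form_kernel2 (R : realType) (f : 'rV[R]_2 -> R) :
  (forall a X Y, f (a *: X + Y) = a * f X + f Y) -> exists2 Z, Z != 0 & f Z = 0.
Proof.
move=> lf; pose d i : 'rV[R]_2 := delta_mx 0 i.
have d0 i : d i != 0.
  by apply/eqP => /rowP/(_ i); rewrite !mxE !eqxx => /eqP; rewrite oner_eq0.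
have f0 := linear_form0 lf.
have [fd|fd] := eqVneq (f (d 0)) 0; first by exists (d 0).
exists (- f (d 1) *: d 0 + (f (d 0) *: d 1 + 0)); last by rewrite !lf f0; ring.
apply/eqP => /rowP/(_ 1); rewrite !mxE/= => /eqP.
by rewrite mulr1 mulr0 add0r addr0 (negbTE fd).
Qed.

(** Two linear forms on a plane with a common nonzero zero [(p, q)] are
    proportional. *)
Lemma common_zero_proportional (R : realType) (p q a0 a1 b0 b1 : R) :
  p * a0 + q * a1 = 0 -> p * b0 + q * b1 = 0 -> p != 0 \/ q != 0 ->
  a0 * b1 = b0 * a1.
Proof.
move=> e1 e2 [p0|q0].
  apply: (mulfI p0); apply/eqP; rewrite -subr_eq0.
  have -> : p * (a0 * b1) - p * (b0 * a1) =
      b1 * (p * a0 + q * a1) - a1 * (p * b0 + q * b1) by ring.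
  by rewrite e1 e2 !mulr0 subrr.
apply: (mulfI q0); apply/eqP; rewrite -subr_eq0.
have -> : q * (a0 * b1) - q * (b0 * a1) =
    a0 * (p * b0 + q * b1) - b0 * (p * a0 + q * a1) by ring.
by rewrite e1 e2 !mulr0 subrr.
Qed.

(** Proportional nonzero linear forms have the same kernel, which is the line of
    [(- b1, b0)]. *)
Lemma proportional_kernel (R : realType) (p q a0 a1 b0 b1 : R) : a0 * b1 = a1 * b0 ->
  a0 != 0 \/ a1 != 0 -> b0 != 0 \/ b1 != 0 -> p * a0 + q * a1 = 0 ->
  exists t, p = - (t * b1) /\ q = t * b0.
Proof.
move=> eab na nb e0; have eb : p * b0 + q * b1 = 0.
  case: na => n; apply: (mulfI n); rewrite mulr0.
    have -> : a0 * (p * b0 + q * b1) = b0 * (p * a0) + q * (a0 * b1) by ring.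
    by rewrite eab -[RHS](mulr0 b0) -e0; ring.
  have -> : a1 * (p * b0 + q * b1) = p * (a1 * b0) + b1 * (q * a1) by ring.
  by rewrite -eab -[RHS](mulr0 b1) -e0; ring.
case: nb => n.
  exists (q / b0); rewrite divfK//; split=> //; apply: (mulIf n).
  by rewrite mulNr mulrAC divfK//; lra.
exists (- (p / b1)); rewrite mulNr divfK// opprK; split=> //; apply: (mulIf n).
by rewrite mulNr mulNr mulrAC divfK//; lra.
Qed.

Lemma row3_last (R : realType) (Y : 'rV[R]_3) :
  Y 0 0 = 0 -> Y 0 1 = 0 -> Y = Y 0 ord_max *: delta_mx 0 ord_max.
Proof.
move=> y0 y1; apply/rowP => -[[|[|[|]]]]// j; rewrite !mxE/=.
- by rewrite mulr0 -[RHS]y0; congr (Y _ _); apply: val_inj.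
- by rewrite mulr0 -[RHS]y1; congr (Y _ _); apply: val_inj.
- by rewrite mulr1; congr (Y _ _); apply: val_inj.
Qed.

(** * The normal connection in block form *)

Section Blocks.
Context {R : realType}.

(** The splitting 6 = 1 + 4 + 1 is that of the frame [(E_0, E_1..E_4, E_5)], in
    which the scalar product and the connection are given by blocks. *)
Definition lcol m (B : 'M[R]_(m, 6)) : 'M[R]_(m, 1) :=
  lsubmx (lsubmx (B : 'M[R]_(m, 1 + 4 + 1)) : 'M[R]_(m, 1 + 4)).
Definition mcols m (B : 'M[R]_(m, 6)) : 'M[R]_(m, 4) :=
  rsubmx (lsubmx (B : 'M[R]_(m, 1 + 4 + 1)) : 'M[R]_(m, 1 + 4)).
Definition rcol m (B : 'M[R]_(m, 6)) : 'M[R]_(m, 1) :=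
  rsubmx (B : 'M[R]_(m, 1 + 4 + 1)).

Lemma row6_mxK m (B : 'M[R]_(m, 6)) :
  row_mx (row_mx (lcol B) (mcols B)) (rcol B) = B :> 'M[R]_(m, 1 + 4 + 1).
Proof. by rewrite /lcol /mcols /rcol !hsubmxK. Qed.

Lemma lcolE m (B : 'M[R]_(m, 6)) i : lcol B i 0 = B i ord0.
Proof. by rewrite !mxE; congr (B i _); apply: val_inj. Qed.

Lemma mcolsE m (B : 'M[R]_(m, 6)) i (j : 'I_4) : mcols B i j = B i (inord j.+1).
Proof.
rewrite !mxE; congr (B i _); apply: val_inj; rewrite /= inordK//.
by rewrite !ltnS ltnW// ltn_ord.
Qed.

Lemma rcolE m (B : 'M[R]_(m, 6)) i : rcol B i 0 = B i ord_max.
Proof. by rewrite !mxE; congr (B i _); apply: val_inj. Qed.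

Lemma mcolsD m (B C : 'M[R]_(m, 6)) : mcols (B + C) = mcols B + mcols C.
Proof. by rewrite /mcols !linearD. Qed.

Lemma rcolD m (B C : 'M[R]_(m, 6)) : rcol (B + C) = rcol B + rcol C.
Proof. by rewrite /rcol !linearD. Qed.

Lemma mcols_mul m n (B : 'M[R]_(m, n)) (C : 'M[R]_(n, 6)) : mcols (B *m C) = B *m mcols C.
Proof.
apply/matrixP => i j; rewrite mcolsE !mxE; apply: eq_bigr => k _.
by rewrite mcolsE.
Qed.

Variables (G : 'rV[R]_4 -> 'M[R]_4) (x : 'rV[R]_4).

Lemma scalar_productE m n (B : 'M[R]_(m, 6)) (C : 'M[R]_(n, 6)) :
  B *m scalar_product G x *m C^T =
  mcols B *m G x *m (mcols C)^T - rcol B *m (lcol C)^T - lcol B *m (rcol C)^T.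
Proof.
rewrite -{1}(row6_mxK B) -{1}(row6_mxK C) /scalar_product.
rewrite (@mul_row_block _ _ (1 + 4) 1 (1 + 4) 1).
rewrite mul_row_block mul_row_col mul_mx_row !mulmx0 !addr0 !add0r.
rewrite (@tr_row_mx _ _ (1 + 4) 1) tr_row_mx.
rewrite add_row_mx !addr0 add0r (@mul_row_col _ _ (1 + 4) 1) mul_row_col.
by rewrite !mul_mx_scalar !scaleN1r !mulNmx [- _ + _]addrC.
Qed.

(** The Levi-Civita part of the normal connection. *)
Definition christoffel_mx (z : 'rV[R]_4) : 'M[R]_4 :=
  \matrix_(a, c) \sum_b christoffel G c a b x * z 0 b.

Lemma mcols_connection m (B : 'M[R]_(m, 6)) (z : 'rV[R]_4) :
  mcols (B *m normal_connection G x z) = lcol B *m z + mcols B *m christoffel_mx z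
    + rcol B *m (z *m normal_tensor G x *m invmx (G x)).
Proof.
rewrite -{1}(row6_mxK B) /normal_connection (@mul_row_block _ _ (1 + 4) 1 (1 + 4) 1).
rewrite /mcols row_mxKl mul_row_block mul_mx_row !mulmx0 add_row_mx row_mxKr.
by rewrite -/(mcols B).
Qed.

Lemma rcol_connection m (B : 'M[R]_(m, 6)) (z : 'rV[R]_4) :
  rcol (B *m normal_connection G x z) = mcols B *m (G x *m z^T).
Proof.
rewrite -{1}(row6_mxK B) /normal_connection (@mul_row_block _ _ (1 + 4) 1 (1 + 4) 1).
by rewrite /rcol row_mxKr mul_row_col !mulmx0 add0r addr0.
Qed.

End Blocks.

Section BilinearForm.
Context {R : realType}.
Implicit Types (g : 'M[R]_4) (u v w : 'rV[R]_4).

Definition bform g u v : R := (u *m g *m v^T) 0 0.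

Lemma bformDl g u v w : bform g (u + v) w = bform g u w + bform g v w.
Proof. by rewrite /bform !mulmxDl mxE. Qed.
Lemma bformDr g u v w : bform g u (v + w) = bform g u v + bform g u w.
Proof. by rewrite /bform linearD/= mulmxDr mxE. Qed.
Lemma bformZl g a u v : bform g (a *: u) v = a * bform g u v.
Proof. by rewrite /bform -!scalemxAl mxE. Qed.
Lemma bformZr g a u v : bform g u (a *: v) = a * bform g u v.
Proof. by rewrite /bform linearZ/= -scalemxAr mxE. Qed.
Lemma bform0l g v : bform g 0 v = 0.
Proof. by rewrite /bform !mul0mx mxE. Qed.
Lemma bformZm a g u v : bform (a *: g) u v = a * bform g u v.
Proof. by rewrite /bform -scalemxAr -scalemxAl mxE. Qed.
Lemma bformC g u v : g^T = g -> bform g u v = bform g v u.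
Proof.
move=> gT; rewrite /bform -[in LHS](trmxK (u *m g *m v^T)) mxE.
by rewrite !trmx_mul trmxK gT mulmxA.
Qed.
Lemma bform_sum g u v : bform g u v = \sum_i \sum_j u 0 i * g i j * v 0 j.
Proof.
rewrite /bform mxE exchange_big/=; apply: eq_bigr => j _.
by rewrite !mxE mulr_suml.
Qed.

Lemma derive_bform p (g : 'rV[R]_p -> 'M[R]_4) (u v : 'rV[R]_p -> 'rV[R]_4) X y :
  differentiable g y -> differentiable u y -> differentiable v y ->
  'D_X (fun z => bform (g z) (u z) (v z)) y =
  bform (g y) ('D_X u y) (v y) + bform ('D_X g y) (u y) (v y) + bform (g y) (u y) ('D_X v y).
Proof.
move=> dg du dv; rewrite /bform.
have dvT : differentiable (fun z => (v z)^T) y.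
  apply/differentiable_mxP => i j; under eq_fun do rewrite mxE.
  by move/differentiable_mxP : dv; apply.
have dug := differentiable_mulmx du dg.
rewrite derive_mx_coord; last exact: differentiable_mulmx.
rewrite derive_mulmx// derive_mulmx// mulmxDl mxE [X in X + _]mxE; congr (_ + _).
congr ((_ *m _) _ _); apply/matrixP => i j.
rewrite -derive_mx_coord// [RHS]mxE -derive_mx_coord//.
by under eq_fun do rewrite mxE.
Qed.

Lemma differentiable_bform p (g : 'rV[R]_p -> 'M[R]_4) (u v : 'rV[R]_p -> 'rV[R]_4) y :
  differentiable g y -> differentiable u y -> differentiable v y ->
  differentiable (fun z => bform (g z) (u z) (v z)) y.
Proof.
move=> dg du dv; rewrite /bform.
have dvT : differentiable (fun z => (v z)^T) y.
  apply/differentiable_mxP => i j; under eq_fun do rewrite mxE.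
  by move/differentiable_mxP : dv; apply.
have := differentiable_mulmx (differentiable_mulmx du dg) dvT.
by move/differentiable_mxP; apply.
Qed.

Lemma smooth_bform p (U : set 'rV[R]_p) (g : 'rV[R]_p -> 'M[R]_4)
    (u v : 'rV[R]_p -> 'rV[R]_4) : open U ->
  smooth_on U g -> smooth_on U u -> smooth_on U v ->
  smooth_on U (fun z => bform (g z) (u z) (v z)).
Proof.
move=> oU sg su sv.
have svT : smooth_on U (fun z => (v z)^T).
  apply/(smooth_mxP _ oU) => i j; under eq_fun do rewrite mxE.
  by move/(smooth_mxP _ oU) : sv; apply.
have := smooth_mulmx oU (smooth_mulmx oU su sg) svT.
by move/(smooth_mxP _ oU); apply.
Qed.

(** Lowering the index cancels the inverse metric in the Christoffel symbols and
    leaves the Koszul formula for constant vector fields. *)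
Lemma bform_christoffel (G : 'rV[R]_4 -> 'M[R]_4) x u v w :
  differentiable G x -> (G x)^T = G x -> G x \in unitmx ->
  bform (G x) (u *m christoffel_mx G x v) w =
  2^-1 * (bform ('D_u G x) v w + bform ('D_v G x) u w - bform ('D_w G x) u v).
Proof.
move=> dG Gs Gu.
pose P a : 'M[R]_4 := 'D_(delta_mx 0 a) G x.
have pE a b d : pderiv a (fun z => G z b d) x = P a b d.
  by rewrite /pderiv derive_mx_coord.
have DE z i j : 'D_z G x i j = \sum_a z 0 a * P a i j.
  by rewrite derive_sum_delta// summxE; apply: eq_bigr => a _; rewrite mxE.
have low a d : (christoffel_mx G x v *m G x) a d =
    2^-1 * \sum_b (P a b d + P b a d - P d a b) * v 0 b.
  rewrite mxE.
  under eq_bigr do rewrite mxE mulr_suml.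
  rewrite exchange_big mulr_sumr/=; apply: eq_bigr => b _.
  transitivity (\sum_c \sum_l 2^-1 * ((P a b l + P b a l - P l a b) * v 0 b) *
      (G x d c * invmx (G x) c l)).
    apply: eq_bigr => c _; rewrite /christoffel mulr_sumr !mulr_suml.
    apply: eq_bigr => l _; rewrite !pE.
    have -> : G x c d = G x d c by rewrite -{1}Gs mxE.
    by ring.
  rewrite exchange_big/= (bigD1 d)//= [X in _ + X]big1 => [|l ld].
    rewrite addr0 -mulr_sumr.
    have -> : \sum_i G x d i * invmx (G x) i d = (G x *m invmx (G x)) d d by rewrite mxE.
    by rewrite mulmxV// mxE eqxx mulr1 mulrA.
  rewrite -mulr_sumr.
  have -> : \sum_i G x d i * invmx (G x) i l = (G x *m invmx (G x)) d l by rewrite mxE.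
  by rewrite mulmxV// mxE eq_sym (negbTE ld) mulr0.
have -> : bform (G x) (u *m christoffel_mx G x v) w = bform (christoffel_mx G x v *m G x) u w.
  by rewrite /bform mulmxA.
pose S (f : 'I_4 -> 'I_4 -> 'I_4 -> R) := \sum_a \sum_d \sum_b f a b d.
have E1 : bform ('D_u G x) v w = S (fun a b d => u 0 a * v 0 b * w 0 d * P a b d).
  rewrite bform_sum exchange_big/= [RHS]exchange_big/=; apply: eq_bigr => d _.
  rewrite [RHS]exchange_big/=; apply: eq_bigr => b _.
  by rewrite DE mulr_sumr mulr_suml; apply: eq_bigr => a _; ring.
have E2 : bform ('D_v G x) u w = S (fun a b d => u 0 a * v 0 b * w 0 d * P b a d).
  rewrite bform_sum; apply: eq_bigr => a _; apply: eq_bigr => d _.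
  by rewrite DE mulr_sumr mulr_suml; apply: eq_bigr => b _; ring.
have E3 : bform ('D_w G x) u v = S (fun a b d => u 0 a * v 0 b * w 0 d * P d a b).
  rewrite bform_sum; apply: eq_bigr => a _; rewrite exchange_big/=; apply: eq_bigr => b _.
  by rewrite DE mulr_sumr mulr_suml; apply: eq_bigr => d _; ring.
rewrite E1 E2 E3 bform_sum /S -big_split -sumrB mulr_sumr/=; apply: eq_bigr => a _.
rewrite -big_split -sumrB mulr_sumr/=; apply: eq_bigr => d _.
rewrite -big_split -sumrB low !mulr_sumr mulr_suml/=; apply: eq_bigr => b _.
by ring.
Qed.

End BilinearForm.

(** * Isotropic frames along a map *)

Section GramMatrix.
Context {R : realType}.

Lemma isotropic_gramE u v : (u < 6)%N -> (v < 6)%N ->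
  isotropic_gram R (inord u) (inord v) =
  if (u + v == 5)%N then if (u == 2)%N || (u == 3)%N then 1 else - 1 else 0.
Proof. by move=> u6 v6; rewrite mxE !inordK// !inE. Qed.

Lemma isotropic_gram_mul l m (w : 'M[R]_(m, 6)) i : (l < 6)%N ->
  (w *m isotropic_gram R) i (inord l) =
  w i (inord (5 - l)) * (if (l == 2)%N || (l == 3)%N then 1 else - 1).
Proof.
move=> l6; rewrite mxE (bigD1 (inord (5 - l)))//= big1 ?addr0 => [|k kl].
  rewrite isotropic_gramE// ?ltnS ?leq_subr// subnK//.
  by congr (_ * _); move: l l6 => [|[|[|[|[|[|]]]]]].
rewrite mxE inordK//; case: eqP => [e|]; last by rewrite mulr0.
case/eqP: kl; apply: val_inj; rewrite /= inordK ?ltnS ?leq_subr//.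
by move: e => /(congr1 (subn^~ l)); rewrite addnK.
Qed.

Lemma isotropic_gram_sqr : isotropic_gram R *m isotropic_gram R = 1%:M.
Proof.
apply/matrixP => u v; rewrite !mxE (bigD1 (rev_ord u))//= big1 ?addr0 => [|k kl].
  rewrite !mxE /= -val_eqE/=; case: u v => [u hu] [v hv] /=.
  by case: u hu => [|[|[|[|[|[|u]]]]]] hu //; case: v hv => [|[|[|[|[|[|v]]]]]] hv //=;
    rewrite ?mulrNN ?mulr1 ?mulr0.
rewrite !mxE; case: eqP => [e|]; last by rewrite mul0r.
case/eqP: kl; apply: val_inj; rewrite /=.
by move: e => /(congr1 (subn^~ u)); rewrite addKn.
Qed.

End GramMatrix.

Section Frame.
Context {R : realType}.
Variables (G : 'rV[R]_4 -> 'M[R]_4) (p : nat) (H : 'rV[R]_p -> 'rV[R]_4).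
Variables (A : 'rV[R]_p -> 'M[R]_6) (U : set 'rV[R]_p).

(** Integral surfaces carry the frames induced from V, whence frames along a map
    H from a space of any dimension. *)
Definition isotropic_frame : Prop :=
  [/\ open U, smooth_on U H, smooth_on U A & forall y, U y ->
    [/\ differentiable G (H y), (G (H y))^T = G (H y),
        exists2 r : R, r != 0 & row ord0 (A y) = r *: base_point R &
        A y *m scalar_product G (H y) *m (A y)^T = isotropic_gram R]].

(** Convertible to [conn_form] when H is a coordinate expression of a
    hypersurface. *)
Definition frame_form (u v : nat) (y X : 'rV[R]_p) : R :=
  (covariant_derivative G H A X y *m invmx (A y)) (inord u) (inord v).

(** The tangent vector of M represented by [A_u] for u = 1, ..., 4; for u = 0
    this is 0. *)
Definition frame_vec (u : nat) (y : 'rV[R]_p) : 'rV[R]_4 := row (inord u) (mcols (A y)).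

Hypothesis frameA : isotropic_frame.

Let oU : open U. Proof. by case: frameA. Qed.
Let sH : smooth_on U H. Proof. by case: frameA. Qed.
Let sA : smooth_on U A. Proof. by case: frameA. Qed.

Lemma scalar_product_entry y m n (B : 'M[R]_(m, 6)) (C : 'M[R]_(n, 6)) i j :
  (B *m scalar_product G (H y) *m C^T) i j =
  bform (G (H y)) (row i (mcols B)) (row j (mcols C))
    - rcol B i 0 * lcol C j 0 - lcol B i 0 * rcol C j 0.
Proof.
have sub3 (M N K : 'M[R]_(m, n)) : (M - N - K) i j = M i j - N i j - K i j.
  by rewrite !mxE.
have outer (b : 'M[R]_(m, 1)) (d : 'M[R]_(n, 1)) : (b *m d^T) i j = b i 0 * d j 0.
  by rewrite mxE big_ord1 [X in _ * X]mxE.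
rewrite scalar_productE sub3 !outer; congr (_ - _ - _).
by rewrite /bform -row_mul mxE [RHS]mxE; apply: eq_bigr => k _; rewrite !mxE.
Qed.

Lemma point_scale y : U y -> A y ord0 ord0 != 0.
Proof.
case: frameA => _ _ _ /[apply] -[_ _ [r r0 e] _].
have -> // : A y ord0 ord0 = r.
by have /rowP/(_ ord0) := e; rewrite !mxE !eqxx mulr1.
Qed.

Lemma point_entries y j : U y -> j != ord0 -> A y ord0 j = 0.
Proof.
case: frameA => _ _ _ /[apply] -[_ _ [r r0 e] _] j0.
by have /rowP/(_ j) := e; rewrite !mxE eqxx (negbTE j0) mulr0.
Qed.

Lemma frame_vec0 y : U y -> frame_vec 0 y = 0.
Proof.
move=> Uy; apply/rowP => j; rewrite /frame_vec [LHS]mxE mcolsE [RHS]mxE.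
have -> : inord 0 = ord0 :> 'I_6 by apply: val_inj; rewrite /= inordK.
apply: point_entries => //; apply/eqP => /(congr1 val); rewrite /= inordK//.
by rewrite !ltnS ltnW.
Qed.

Lemma gram_entry y u v : U y -> (u < 6)%N -> (v < 6)%N ->
  bform (G (H y)) (frame_vec u y) (frame_vec v y)
    - A y (inord u) ord_max * A y (inord v) ord0
    - A y (inord u) ord0 * A y (inord v) ord_max =
  if (u + v == 5)%N then if (u == 2)%N || (u == 3)%N then 1 else - 1 else 0.
Proof.
move=> Uy u6 v6; case: frameA => _ _ _ /(_ _ Uy)[_ _ _ e].
by rewrite -isotropic_gramE// -e scalar_product_entry !lcolE !rcolE.
Qed.

Let inord0 : inord 0 = ord0 :> 'I_6.
Proof. by apply: val_inj; rewrite /= inordK. Qed.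

(** [A_0] is a multiple of [E_0], which pairs with [E_5] alone, and
    [(A_0, A_u) = 0] unless u = 5. *)
Lemma rcol_frame y u : U y -> (u < 5)%N -> A y (inord u) ord_max = 0.
Proof.
move=> Uy u5; have u6 : (u < 6)%N by exact: ltnW.
have := @gram_entry y 0%N u Uy isT u6.
rewrite frame_vec0// bform0l inord0 point_entries// mul0r subrr sub0r add0n (ltn_eqF u5).
by move/eqP; rewrite oppr_eq0 mulf_eq0 (negbTE (point_scale Uy)) => /eqP.
Qed.

Lemma frame_vec_gram y u v : U y -> (u < 5)%N -> (v < 5)%N ->
  bform (G (H y)) (frame_vec u y) (frame_vec v y) =
  if (u + v == 5)%N then if (u == 2)%N || (u == 3)%N then 1 else - 1 else 0.
Proof.
move=> Uy u5 v5; rewrite -(gram_entry Uy (ltnW u5) (ltnW v5)).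
by rewrite !rcol_frame// mul0r mulr0 !subr0.
Qed.

Lemma frame_unit y : U y -> A y \in unitmx.
Proof.
move=> Uy; case: frameA => _ _ _ /(_ _ Uy)[_ _ _ e].
have : isotropic_gram R \in unitmx by case/mulmx1_unit: (@isotropic_gram_sqr R).
by rewrite -e !unitmx_mul => /andP[/andP[]].
Qed.

(** The Gram matrix of [A_1, ..., A_4] is invertible. *)
Lemma metric_unit y : U y -> G (H y) \in unitmx.
Proof.
move=> Uy.
pose X : 'M[R]_4 := \matrix_(i < 4) frame_vec i.+1 y.
pose Q : 'M[R]_4 := \matrix_(i, j) if (i.+1 + j.+1 == 5)%N then
  if (i.+1 == 2)%N || (i.+1 == 3)%N then 1 else - 1 else 0.
have e : X *m G (H y) *m X^T = Q.
  have i5 (i : 'I_4) : (i.+1 < 5)%N by rewrite ltnS.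
  apply/matrixP => i j; rewrite [RHS]mxE -(frame_vec_gram Uy (i5 i) (i5 j)).
  rewrite /bform mxE [RHS]mxE; apply: eq_bigr => k _; rewrite !mxE.
  by congr (_ * _); apply: eq_bigr => l _; rewrite !mxE.
have QQ : Q *m Q = 1%:M.
  apply/matrixP => i j; rewrite !mxE (bigD1 (rev_ord i))//= big1 ?addr0 => [|k kl].
    rewrite !mxE /= -val_eqE/=; case: i j => [i hi] [j hj] /=.
    by case: i hi => [|[|[|[|i]]]] hi //; case: j hj => [|[|[|[|j]]]] hj //=;
      rewrite ?mulrNN ?mulr1 ?mulr0.
  rewrite !mxE; case: eqP => [ik|]; last by rewrite mul0r.
  case/eqP: kl; apply: val_inj; rewrite /=.
  by move: ik => [] /(congr1 (subn^~ i.+1)); rewrite -addSnnS addKn => ->.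
have /mulmx1_unit[+ _] := QQ.
by rewrite -e !unitmx_mul => /andP[/andP[]].
Qed.

Let dA y : U y -> differentiable A y. Proof. exact: smooth_differentiable. Qed.
Let dH y : U y -> differentiable H y. Proof. exact: smooth_differentiable. Qed.

Lemma derive_entry_cst0 X y i j : U y -> (forall z, U z -> A z i j = 0) ->
  ('D_X A y) i j = 0.
Proof.
move=> Uy h; rewrite -derive_mx_coord; last exact: dA.
exact: derive_cst_on oU h Uy.
Qed.

Lemma derive_frame_vec u X y : U y -> 'D_X (frame_vec u) y = row (inord u) (mcols ('D_X A y)).
Proof.
move=> Uy; have /differentiable_mxP dAe := dA Uy.
have dx : differentiable (frame_vec u) y.
  apply/differentiable_mxP => i j; under eq_fun do rewrite /frame_vec mxE mcolsE.
  exact: dAe.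
apply/rowP => j; rewrite -derive_mx_coord//; under eq_fun do rewrite /frame_vec mxE mcolsE.
by rewrite (derive_mx_coord _ _ _ (dA Uy)) [RHS]mxE mcolsE.
Qed.

Lemma differentiable_frame_vec u y : U y -> differentiable (frame_vec u) y.
Proof.
move=> /dA/differentiable_mxP dAe.
by apply/differentiable_mxP => i j; under eq_fun do rewrite /frame_vec mxE mcolsE.
Qed.

Lemma mcols_covariant u X y : U y -> (u < 5)%N ->
  row (inord u) (mcols (covariant_derivative G H A X y)) =
  'D_X (frame_vec u) y + A y (inord u) ord0 *: 'D_X H y +
  frame_vec u y *m christoffel_mx G (H y) ('D_X H y).
Proof.
move=> Uy u5; rewrite /covariant_derivative mcolsD mcols_connection !linearD/=.
rewrite !row_mul -derive_frame_vec// addrA.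
have -> : row (inord u) (rcol (A y)) = 0.
  by apply/rowP => j; rewrite !ord1 mxE rcolE rcol_frame// mxE.
rewrite mul0mx addr0 addrA; congr (_ + _ + _).
apply/rowP => j; rewrite mxE big_ord1 [RHS]mxE; congr (_ * _).
by rewrite mxE lcolE.
Qed.

Lemma rcol_covariant u X y : U y -> (u < 5)%N ->
  rcol (covariant_derivative G H A X y) (inord u) 0 =
  bform (G (H y)) (frame_vec u y) ('D_X H y).
Proof.
move=> Uy u5; rewrite /covariant_derivative rcolD rcol_connection mxE rcolE.
rewrite derive_entry_cst0//; last by move=> z Uz; exact: rcol_frame.
rewrite add0r /bform /frame_vec -mulmxA -row_mul.
by rewrite [RHS]mxE.
Qed.

Lemma frame_form_mul X y : U y ->
  (covariant_derivative G H A X y *m invmx (A y)) *m A y = covariant_derivative G H A X y.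
Proof. by move=> Uy; rewrite mulmxKV// frame_unit. Qed.

(** The coefficient of [dA_u] on [A_(5-l)] is found by pairing with [A_l], to
    which all the other frame vectors are orthogonal. *)
Lemma frame_formE u l X y : U y -> (u < 5)%N -> (l < 5)%N ->
  frame_form u (5 - l) y X * (if (l == 2)%N || (l == 3)%N then 1 else - 1) =
  bform (G (H y)) ('D_X (frame_vec u) y + A y (inord u) ord0 *: 'D_X H y +
     frame_vec u y *m christoffel_mx G (H y) ('D_X H y)) (frame_vec l y)
  - bform (G (H y)) (frame_vec u y) ('D_X H y) * A y (inord l) ord0.
Proof.
move=> Uy u5 l5.
case: frameA => _ _ _ /(_ _ Uy)[_ _ _ e].
rewrite /frame_form -(isotropic_gram_mul _ _ (ltnW l5)) -e !mulmxA frame_form_mul//.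
rewrite scalar_product_entry mcols_covariant// rcol_covariant// lcolE rcolE rcol_frame//.
by rewrite mulr0 subr0.
Qed.

Definition gram_sign (l : nat) : R := if (l == 2)%N || (l == 3)%N then 1 else - 1.

(** [A_0] is a multiple of the point itself, and differentiating the factor
    contributes to [omega_0^0] only. So [omega^j] is, up to a factor, the metric
    pairing of the tangent vector with [A_(5-j)]: it does not involve the
    derivatives of the frame. *)
Lemma coframeE j X y : U y -> (0 < j < 6)%N ->
  frame_form 0 j y X =
  gram_sign (5 - j) * (A y ord0 ord0 * bform (G (H y)) ('D_X H y) (frame_vec (5 - j) y)).
Proof.
move=> Uy /andP[j0 j6]; have j5 : (5 - j < 5)%N by rewrite ltn_subrL j0.
have := frame_formE X Uy (isT : 0 < 5)%N j5; rewrite subKn//.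
have -> : 'D_X (frame_vec 0) y = 0.
  exact: derive_cst_on oU frame_vec0 Uy.
rewrite inord0 frame_vec0// bform0l mul0r subr0 mul0mx addr0 add0r bformZl => <-.
by rewrite /gram_sign; case: ifP => _; ring.
Qed.

Lemma coframe_linear j y a X Y : U y -> (0 < j < 6)%N ->
  frame_form 0 j y (a *: X + Y) = a * frame_form 0 j y X + frame_form 0 j y Y.
Proof.
move=> Uy j06; rewrite !coframeE// (derive_linear_dir (dH Uy)) bformDl bformZl.
move: (bform _ ('D_X H y) _) (bform _ ('D_Y H y) _) (gram_sign _) (A y _ _).
by move=> bX bY s r; ring.
Qed.

Lemma tangent_expansion X y : U y ->
  A y ord0 ord0 *: 'D_X H y = frame_form 0 1 y X *: frame_vec 1 y +
    frame_form 0 2 y X *: frame_vec 2 y + frame_form 0 3 y X *: frame_vec 3 y +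
    frame_form 0 4 y X *: frame_vec 4 y.
Proof.
move=> Uy; have := mcols_covariant X Uy (isT : 0 < 5)%N.
rewrite -(frame_form_mul X Uy) mcols_mul row_mul mulmx_sum_row.
have -> : 'D_X (frame_vec 0) y = 0.
  exact: derive_cst_on oU frame_vec0 Uy.
rewrite frame_vec0// mul0mx addr0 add0r inord0 => <-.
transitivity (\sum_(i < 6) frame_form 0 i y X *: frame_vec i y).
  by apply: eq_bigr => i _; rewrite /frame_form /frame_vec inord_val mxE inord0.
rewrite !big_ord_recr big_ord0/= frame_vec0// scaler0 !add0r.
rewrite (coframeE X Uy (isT : 0 < 5 < 6)%N) subnn frame_vec0//.
by rewrite bformC ?bform0l ?mulr0 ?scale0r ?addr0//; case: frameA => _ _ _ /(_ _ Uy)[].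
Qed.

Lemma tangent_gram y (a1 a2 a3 b1 b2 b3 : R) : U y ->
  bform (G (H y)) (a1 *: frame_vec 1 y + a2 *: frame_vec 2 y + a3 *: frame_vec 3 y)
    (b1 *: frame_vec 1 y + b2 *: frame_vec 2 y + b3 *: frame_vec 3 y) = a2 * b3 + a3 * b2.
Proof.
move=> Uy; rewrite !bformDl !bformDr !bformZl !bformZr !frame_vec_gram//=; ring.
Qed.

(** The first fundamental form [I = 2 omega^2 omega^3], polarized. *)
Lemma tangent_bform X Y y : U y -> frame_form 0 4 y X = 0 -> frame_form 0 4 y Y = 0 ->
  A y ord0 ord0 ^+ 2 * bform (G (H y)) ('D_X H y) ('D_Y H y) =
  frame_form 0 2 y X * frame_form 0 3 y Y + frame_form 0 3 y X * frame_form 0 2 y Y.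
Proof.
move=> Uy X4 Y4.
have -> : A y ord0 ord0 ^+ 2 * bform (G (H y)) ('D_X H y) ('D_Y H y) =
  bform (G (H y)) (A y ord0 ord0 *: 'D_X H y) (A y ord0 ord0 *: 'D_Y H y).
  by rewrite bformZl bformZr expr2 mulrA.
have eX := tangent_expansion X Uy; rewrite X4 scale0r addr0 in eX.
have eY := tangent_expansion Y Uy; rewrite Y4 scale0r addr0 in eY.
apply: etrans (congr2 (bform (G (H y))) eX eY) _; exact: tangent_gram.
Qed.

(** When Y is sent to a multiple of [A_(5-k)], two of the three terms of the
    Koszul formula cancel, and the [E_0]-components of [A_1] and [A_(5-k)] do not
    contribute because [A_(5-k)] is null and orthogonal to [A_1]. *)
Lemma second_form_coeff k Y b y : U y -> (k == 2)%N || (k == 3)%N ->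
  'D_Y H y = b *: frame_vec (5 - k) y ->
  frame_form 1 k y Y = bform (G (H y)) ('D_Y (frame_vec 1) y) (frame_vec (5 - k) y) +
    b / 2 * bform ('D_(frame_vec 1 y) G (H y)) (frame_vec (5 - k) y) (frame_vec (5 - k) y).
Proof.
move=> Uy k23 HY; set l := (5 - k)%N in HY *.
have l5 : (l < 5)%N by rewrite /l; case/orP: k23 => /eqP->.
have kl : k = (5 - l)%N by rewrite /l; case/orP: k23 => /eqP->.
have l23 : (l == 2)%N || (l == 3)%N by rewrite /l; case/orP: k23 => /eqP->.
have [_ _ _ /(_ _ Uy)[dG Gs _ _]] := frameA.
have gll : bform (G (H y)) (frame_vec l y) (frame_vec l y) = 0.
  by rewrite frame_vec_gram//; case/orP: l23 => /eqP->.
have g1l : bform (G (H y)) (frame_vec 1 y) (frame_vec l y) = 0.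
  by rewrite frame_vec_gram//; case/orP: l23 => /eqP->.
pose Dg (v : 'rV[R]_4) : 'M[R]_4 := 'D_v G (H y).
have scale c v : Dg (c *: v) = c *: Dg v by rewrite /Dg !deriveE// linearZ.
have chr u v w : bform (G (H y)) (u *m christoffel_mx G (H y) v) w =
    2^-1 * (bform (Dg u) v w + bform (Dg v) u w - bform (Dg w) u v).
  by apply: bform_christoffel => //; exact: metric_unit.
have := frame_formE Y Uy (isT : 1 < 5)%N l5.
rewrite -/(Dg (frame_vec 1 y)) -kl l23 mulr1 => ->.
move: ('D_Y (frame_vec 1) y) => dx1; rewrite HY !bformDl chr; clearbody Dg.
rewrite !scale !bformZm !bformZl !bformZr gll g1l.
move: (bform _ dx1 _) (bform (Dg (frame_vec 1 y)) _ _) (bform (Dg (frame_vec l y)) _ _).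
by move=> c1 c2 c3; field.
Qed.

(** The computation behind the structure equation, at one point, with
    [x1 = A_1] and [xl = A_l]. The last two hypotheses are the derivatives of
    [(A_l, A_l) = 0] along X and of [(A_1, A_l) = 0] along Y. *)
Lemma structure_algebra (g g1 gl gX gY : 'M[R]_4)
    (x1 xl zX zY dXY dYX xX xY x1Y : 'rV[R]_4) (a b : R) : g^T = g ->
  zX = a *: x1 -> zY = b *: xl -> gX = a *: g1 -> gY = b *: gl -> dXY = dYX ->
  bform g xX xl + bform gX xl xl + bform g xl xX = 0 ->
  bform g x1Y xl + bform gY x1 xl + bform g x1 xY = 0 ->
  bform g dXY xl + bform gX zY xl + bform g zY xX
  - (bform g dYX xl + bform gY zX xl + bform g zX xY) =
  a * (bform g x1Y xl + b / 2 * bform g1 xl xl).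
Proof.
move=> gs -> -> -> -> ->; rewrite !bformZm !bformZl (bformC xl xX gs).
move: (bform g xX xl) (bform g1 xl xl) (bform g x1Y xl) (bform gl x1 xl)
  (bform g x1 xY) (bform g dYX xl) => c1 c2 c3 c4 c5 c6 e1 e2.
have -> : c1 = - (a * c2) / 2 by lra.
have -> : c5 = - c3 - b * c4 by lra.
by field.
Qed.

(** The equation [d omega^k = omega_0^0 /\ omega^k + omega^j /\ omega_j^k] on two
    vectors that are sent to multiples of [A_1] and [A_(5-k)]. There [omega^k] and
    [omega^4] are zero, and so is the form [omega_j^k] for j = 5 - k; what
    remains is [omega^1 /\ omega_1^k]. The exterior derivative is that of the
    pairing with [A_(5-k)], which is [omega^k] up to a factor; the two exterior
    derivatives are proportional on these vectors, on which [omega^k] is zero. *)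
Lemma structure_equation k X Y a b y : U y -> (k == 2)%N || (k == 3)%N ->
  'D_X H y = a *: frame_vec 1 y -> 'D_Y H y = b *: frame_vec (5 - k) y ->
  'D_X (fun z => bform (G (H z)) ('D_Y H z) (frame_vec (5 - k) z)) y -
  'D_Y (fun z => bform (G (H z)) ('D_X H z) (frame_vec (5 - k) z)) y =
  a * frame_form 1 k y Y.
Proof.
move=> Uy k23 HX HY; rewrite (second_form_coeff Uy k23 HY).
set l := (5 - k)%N in HY *.
have l5 : (l < 5)%N by rewrite /l; case/orP: k23 => /eqP->.
have [_ _ _ /(_ _ Uy)[dG Gs _ _]] := frameA.
have dGH : differentiable (fun z => G (H z)) y.
  by apply: (@differentiable_comp _ _ _ _ H G); [exact: dH|].
have DGH Z c v : 'D_Z H y = c *: v ->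
    'D_Z (fun z => G (H z)) y = c *: 'D_v G (H y).
  move=> e; apply: etrans (derive_comp Z (dH Uy) dG) _.
  by rewrite e !deriveE// linearZ.
have dDH Z : differentiable ('D_Z H) y.
  exact: smooth_differentiable (smooth_derive _ sH) Uy.
have dx u := differentiable_frame_vec u Uy.
have DG0 Z u v : (u < 5)%N -> (v < 5)%N ->
  bform (G (H y)) ('D_Z (frame_vec u) y) (frame_vec v y) +
  bform ('D_Z (fun z => G (H z)) y) (frame_vec u y) (frame_vec v y) +
  bform (G (H y)) (frame_vec u y) ('D_Z (frame_vec v) y) = 0.
  move=> u5 v5; apply: etrans (esym (derive_bform Z dGH (dx u) (dx v))) _.
  exact: derive_cst_on oU (fun z Uz => frame_vec_gram Uz u5 v5) Uy.
have e1 := DG0 X l l l5 l5; have e2 := DG0 Y 1%N l isT l5.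
have DX := derive_bform X dGH (dDH Y) (dx l).
have DY := derive_bform Y dGH (dDH X) (dx l).
apply: etrans (congr2 (fun s t => s - t) DX DY) _ => {DX DY}.
exact: (structure_algebra Gs HX HY (DGH _ _ _ HX) (DGH _ _ _ HY)
  (derive_swap X Y oU sH Uy) e1 e2).
Qed.

End Frame.

(** * Change of parametrization and of chart *)

Section Pullback.
Context {R : realType}.
Variables (G : 'rV[R]_4 -> 'M[R]_4) (p q : nat).
Variables (H : 'rV[R]_p -> 'rV[R]_4) (A : 'rV[R]_p -> 'M[R]_6) (U : set 'rV[R]_p).
Variables (f : 'rV[R]_q -> 'rV[R]_p) (W : set 'rV[R]_q).
Hypotheses (frameA : isotropic_frame G H A U) (oW : open W) (sf : smooth_on W f).

Let W' : set 'rV[R]_q := W `&` f @^-1` U.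

Lemma open_pullback : open W'.
Proof.
case: frameA => oU _ _ _; apply: open_preimage_on => // x Wx.
by apply/differentiable_continuous; exact: smooth_differentiable sf Wx.
Qed.

Lemma isotropic_frame_comp : isotropic_frame G (H \o f) (A \o f) W'.
Proof.
case: frameA => oU sH sA h; have oW' := open_pullback.
have sf' : smooth_on W' f by apply: smooth_sub sf => x [].
by split=> //; [apply: (smooth_comp oW' oU) => // x []..|move=> y [_]; exact: h].
Qed.

Lemma derive_jacobian_comp m n (F : 'rV[R]_p -> 'M[R]_(m, n)) z Z : W' z ->
  smooth_on U F -> 'D_Z (F \o f) z = 'D_(Z *m 'J f z) F (f z).
Proof.
move=> [Wz Uz] sF; have df := smooth_differentiable sf Wz.
by rewrite derive_comp ?deriveEjacobian//; exact: smooth_differentiable sF Uz.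
Qed.

Lemma frame_form_comp u v z Z : W' z ->
  frame_form G (H \o f) (A \o f) u v z Z = frame_form G H A u v (f z) (Z *m 'J f z).
Proof.
move=> Wz; case: frameA => oU sH sA _.
rewrite /frame_form /covariant_derivative.
have eA := derive_jacobian_comp Z Wz sA; have eH := derive_jacobian_comp Z Wz sH.
have gen (a1 a2 : 'M[R]_6) (z1 z2 : 'rV[R]_4) : a1 = a2 -> z1 = z2 ->
  ((a1 + A (f z) *m normal_connection G (H (f z)) z1) *m invmx (A (f z)))
    (inord u) (inord v) =
  ((a2 + A (f z) *m normal_connection G (H (f z)) z2) *m invmx (A (f z)))
    (inord u) (inord v) by move=> -> ->.
exact: gen eA eH.
Qed.

End Pullback.

Section Charts.
Context {R : realType} {n : nat} {N : manifold R n}.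
Implicit Types a b : chart R n N.

Lemma overlap_open a b : open (overlap a b).
Proof.
apply: open_preimage_on => [|x ax|]; [exact: cimg_open| |exact: cdom_open].
exact: cinv_continuous.
Qed.

Lemma transition_overlap a b y : overlap a b y -> overlap b a (transition a b y).
Proof.
case=> ay by_; split; rewrite /transition /=; first exact: cmap_img.
by rewrite /preimage/= cmapK//; exact: cinv_dom.
Qed.

Lemma transitionK a b y : overlap a b y -> transition b a (transition a b y) = y.
Proof. by case=> ay by_; rewrite /transition /= cmapK// cinvK. Qed.

Lemma cinv_transition a b y : overlap a b y -> cinv b (transition a b y) = cinv a y.
Proof. by case=> ay by_; rewrite /transition /= cmapK. Qed.

Lemma transition_smooth a b : atlas a -> atlas b ->
  smooth_on (overlap a b) (transition a b).
Proof. by move=> aa ab; case: (atlas_compatible aa ab). Qed.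

Lemma jacobian_transitionK a b y : atlas a -> atlas b -> overlap a b y ->
  'J (transition a b) y *m 'J (transition b a) (transition a b y) = 1%:M.
Proof.
move=> aa ab oy; have oy' := transition_overlap oy.
have d1 := smooth_differentiable (transition_smooth aa ab) oy.
have d2 := smooth_differentiable (transition_smooth ab aa) oy'.
apply/row_matrixP => i; rewrite !rowE mulmxA mulmx1.
rewrite -deriveEjacobian// -deriveEjacobian//.
apply: etrans (esym (derive_comp _ d1 d2)) _.
transitivity ('D_(delta_mx 0 i) id y); last exact: derive_id.
apply: near_eq_derive.
have : nbhs y (overlap a b) by apply: open_nbhs_nbhs; split=> //; exact: overlap_open.
by apply: filterS => z oz; rewrite /= transitionK.
Qed.

Lemma dist_transition (D : plane_field N) a b y X : atlas a -> atlas b ->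
  overlap a b y ->
  D b (transition a b y) X <-> D a y (X *m 'J (transition b a) (transition a b y)).
Proof.
move=> aa ab oy; have oy' := transition_overlap oy.
have JK := mulmx1C (jacobian_transitionK aa ab oy).
have := dist_compatible D (X *m 'J (transition b a) (transition a b y)) aa ab oy.
by rewrite -mulmxA JK mulmx1 => ->.
Qed.

(** An integral submanifold is given in some chart; a transition map carries it
    to any other one. *)
Lemma integral_submanifold_chart k (D : plane_field N) :
  integrable_distribution k D -> forall chi y, atlas chi -> cimg chi y ->
  exists (O : set 'rV[R]_k) (h : 'rV[R]_k -> 'rV[R]_n),
    [/\ open O, O 0, h 0 = y & smooth_on O h] /\
    [/\ forall u, O u -> cimg chi (h u),
        forall u, O u -> row_free ('J h u) &
        forall u X, O u -> D chi (h u) X <-> (X <= 'J h u)%MS].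
Proof.
move=> iD chi y achi cy.
have [chi1 [B1 [h1 [[a1 d1 oB1 B10 h10] [sh1 ch1 free1 tan1]]]]] := iD (cinv chi y).
have oO : open (B1 `&` h1 @^-1` overlap chi1 chi).
  apply: open_preimage_on => // [u B1u|]; last exact: overlap_open.
  by apply/differentiable_continuous; exact: smooth_differentiable sh1 B1u.
have st := transition_smooth a1 achi.
have J u : B1 u -> overlap chi1 chi (h1 u) ->
    'J (transition chi1 chi \o h1) u = 'J h1 u *m 'J (transition chi1 chi) (h1 u).
  move=> B1u ou; apply: jacobian_comp; first exact: smooth_differentiable sh1 B1u.
  exact: smooth_differentiable st ou.
exists (B1 `&` h1 @^-1` overlap chi1 chi), (transition chi1 chi \o h1).
split; split => //.
- split => //; rewrite /preimage/= h10; split; first exact: cmap_img.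
  by rewrite /preimage/= cmapK//; exact: cinv_dom.
- by rewrite /= h10 /transition/= cmapK// cinvK.
- apply: (@smooth_comp R _ _ _ (overlap chi1 chi) 1 n h1 (transition chi1 chi)) => //.
  + exact: overlap_open.
  + by move=> x [].
  + by apply: smooth_sub sh1 => x [].
- by move=> u [B1u ou]; have [] := transition_overlap ou.
- move=> u [B1u ou]; rewrite J//; apply/row_freeP.
  have [B hB] := row_freeP (free1 u B1u).
  exists ('J (transition chi chi1) (transition chi1 chi (h1 u)) *m B).
  by rewrite mulmxA -(mulmxA ('J h1 u)) jacobian_transitionK// mulmx1.
- move=> u X [B1u ou]; apply: iff_trans (dist_transition D X a1 achi ou) _.
  apply: iff_trans (tan1 _ _ B1u) _; rewrite (J u B1u ou).
  have JK := jacobian_transitionK a1 achi ou.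
  have JK' : 'J (transition chi chi1) (transition chi1 chi (h1 u)) *m
      'J (transition chi1 chi) (h1 u) = 1%:M by rewrite (mulmx1C JK).
  split=> [|] /submxMr h.
    by have := h _ ('J (transition chi1 chi) (h1 u)); rewrite -mulmxA JK' mulmx1.
  have := h _ ('J (transition chi chi1) (transition chi1 chi (h1 u))).
  by rewrite -mulmxA JK mulmx1.
Qed.

End Charts.

(** * First-order frames of a hypersurface *)

Section Hypersurface.
Context {R : realType} {M : manifold R 4} (c : conformal22 M).
Context {V : manifold R 3} (iota : V -> M).
Hypothesis imm : immersion iota.

Lemma coord_rep_smooth chi phi : atlas chi -> atlas phi ->
  smooth_on (cimg chi `&` ((iota \o cinv chi) @^-1` cdom phi)) (coord_rep iota chi phi).
Proof. by move=> achi aphi; have [h _] := imm; have [_] := h chi achi phi aphi. Qed.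

Lemma coord_rep_free chi phi y : atlas chi -> atlas phi -> cimg chi y ->
  cdom phi (iota (cinv chi y)) -> row_free ('J (coord_rep iota chi phi) y).
Proof. by have [_ h] := imm => *; apply: h. Qed.

Lemma first_order_isotropic chi phi A (O : set 'rV[R]_3) :
  first_order_frame c iota chi phi A O ->
  isotropic_frame (metric c phi) (coord_rep iota chi phi) A O.
Proof.
move=> [[achi aphi oO Osub sA] hO]; split => //.
  exact: smooth_sub Osub (coord_rep_smooth achi aphi).
move=> y Oy; have [[r r0 er] eg _] := hO y Oy; have [cy dy] := Osub y Oy.
have cphi : cimg phi (coord_rep iota chi phi y) by exact: cmap_img.
split=> //; last by exists r.
  exact: smooth_differentiable (metric_smooth c aphi) cphi.
exact: (@Defs.metric_sym _ _ c _ _ aphi cphi).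
Qed.

Section Frame.
Variables (chi : chart R 3 V) (phi : chart R 4 M) (A : 'rV[R]_3 -> 'M[R]_6).
Variable O : set 'rV[R]_3.
Hypothesis frameA : first_order_frame c iota chi phi A O.

Local Notation G := (metric c phi).
Local Notation H := (coord_rep iota chi phi).
Local Notation omega := (coframe c iota chi phi A).
Local Notation e := (dual_basis c iota chi phi A).

Let isoA : isotropic_frame G H A O. Proof. exact: first_order_isotropic. Qed.

Lemma coframe4 y X : O y -> frame_form G H A 0 4 y X = 0.
Proof. by case: frameA => _ h /h[_ _]; exact. Qed.

Lemma tangent_expansion3 y X : O y ->
  A y ord0 ord0 *: 'D_X H y =
  omega 1 y X *: frame_vec A 1 y + omega 2 y X *: frame_vec A 2 y + omega 3 y X *: frame_vec A 3 y.
Proof.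
by move=> Oy; rewrite (tangent_expansion isoA X Oy) coframe4// scale0r addr0.
Qed.

Lemma frame_differentiable y : O y -> differentiable H y.
Proof. by case: isoA => _ sH _ _ /(smooth_differentiable sH). Qed.

Lemma coframe_free y X : O y -> (forall j, (0 < j < 4)%N -> omega j y X = 0) -> X = 0.
Proof.
move=> Oy h; have := tangent_expansion3 X Oy; rewrite !h// !scale0r !addr0 => /eqP.
rewrite scaler_eq0 (negbTE (point_scale isoA Oy))/=.
rewrite (deriveEjacobian _ (frame_differentiable Oy)) => /eqP XJ.
case: frameA => -[achi aphi _ Osub _] _; have [cy dy] := Osub y Oy.
have [B hB] := row_freeP (coord_rep_free achi aphi cy dy).
by rewrite -[X]mulmx1 -hB mulmxA XJ mul0mx.
Qed.

Definition coframe_mx y : 'M[R]_3 := \matrix_(a, j) omega j.+1 y (delta_mx 0 a).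

Lemma mul_coframe_mx y X : O y -> X *m coframe_mx y = \row_j omega j.+1 y X.
Proof.
move=> Oy; apply/rowP => j; rewrite !mxE.
have j6 : (0 < j.+1 < 6)%N by rewrite ltnS /= ltnS (leq_trans (ltn_ord j)).
have lin := coframe_linear isoA _ _ _ Oy j6.
apply: etrans (esym (linear_row_sum (fun a X Y => lin a X Y) X)).
by apply: eq_bigr => a _; rewrite mxE.
Qed.

Lemma coframe_mx_unit y : O y -> coframe_mx y \in unitmx.
Proof.
move=> Oy; rewrite -row_free_unit -kermx_eq0; apply/rowV0P => X /sub_kermxP XC.
apply: (coframe_free Oy) => j /andP[j0 j4].
have := mul_coframe_mx X Oy; rewrite XC => /rowP/(_ (inord j.-1)).
by rewrite !mxE inordK ?prednK// -ltnS prednK.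
Qed.

Lemma coframe_dual y i j : O y -> (0 < i < 4)%N -> (0 < j < 4)%N ->
  omega j y (e i y) = (i == j)%:R.
Proof.
move=> Oy /andP[i0 i4] /andP[j0 j4].
have key : e i y *m coframe_mx y = row (inord i.-1) 1%:M.
  by rewrite -[e i y]/(row (inord i.-1) (invmx (coframe_mx y))) -row_mul mulVmx ?coframe_mx_unit.
move: key; rewrite mul_coframe_mx//; move: (e i y) => E /rowP/(_ (inord j.-1)).
rewrite mxE inordK; last by rewrite -ltnS prednK.
rewrite prednK// => ->; rewrite mxE mxE -val_eqE/= !inordK; first last.
- by rewrite -ltnS prednK.
- by rewrite -ltnS prednK.
by case: i i0 {i4} => // i _; case: j j0 {j4}.
Qed.

Lemma dual_expansion y X : O y ->
  X = omega 1 y X *: e 1 y + omega 2 y X *: e 2 y + omega 3 y X *: e 3 y.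
Proof.
move=> Oy; rewrite -[LHS](mulmxK (coframe_mx_unit Oy)) mul_coframe_mx// mulmx_sum_row.
rewrite !big_ord_recr big_ord0/= add0r !mxE /dual_basis.
have e1 : inord 0 = widen_ord (leqnSn 2) (widen_ord (leqnSn 1) ord_max) :> 'I_3.
  by apply: val_inj; rewrite /= inordK.
have e2 : inord 1 = widen_ord (leqnSn 2) ord_max :> 'I_3.
  by apply: val_inj; rewrite /= inordK.
have e3 : inord 2 = ord_max :> 'I_3 by apply: val_inj; rewrite /= inordK.
by rewrite /= e1 e2 e3.
Qed.

Lemma tangent_dual i y : O y -> (0 < i < 4)%N ->
  'D_(e i y) H y = (A y ord0 ord0)^-1 *: frame_vec A i y.
Proof.
move=> Oy i03; have r0 := point_scale isoA Oy; apply: (scalerI r0).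
rewrite tangent_expansion3// !coframe_dual// scalerA (mulfV r0) scale1r.
by move: i i03 => [|[|[|[|]]]]// _; rewrite ?scale1r ?scale0r ?addr0 ?add0r.
Qed.

Lemma omega_bform y X Y : O y ->
  A y ord0 ord0 ^+ 2 * bform (G (H y)) ('D_X H y) ('D_Y H y) =
  omega 2 y X * omega 3 y Y + omega 3 y X * omega 2 y Y.
Proof. by move=> Oy; rewrite (tangent_bform isoA)// coframe4. Qed.

Lemma omega_linear j y a X Y : O y -> (0 < j < 4)%N ->
  omega j y (a *: X + Y) = a * omega j y X + omega j y Y.
Proof.
move=> Oy /andP[j0 j4]; apply: (coframe_linear isoA) => //.
by rewrite j0 (ltn_trans j4).
Qed.

End Frame.

(** Integral surfaces and ruled charts come with charts of V unrelated to those of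
    the given frames, to which the frames have to be carried. *)
Lemma frame_transport chi0 phi A (O : set 'rV[R]_3) chi :
  first_order_frame c iota chi0 phi A O -> atlas chi ->
  let O' := overlap chi chi0 `&` transition chi chi0 @^-1` O in
  first_order_frame c iota chi phi (A \o transition chi chi0) O' /\
  forall u v y X, O' y -> conn_form c iota chi phi (A \o transition chi chi0) u v y X =
    conn_form c iota chi0 phi A u v (transition chi chi0 y)
      (X *m 'J (transition chi chi0) y).
Proof.
move=> frA achi O'; have isoA := first_order_isotropic frA.
have [[achi0 aphi oO Osub sA] hO] := frA.
have st := transition_smooth achi achi0.
have oV : open (overlap chi chi0) by exact: overlap_open.
have isoA' := isotropic_frame_comp isoA oV st.
have oO' : open O' by case: isoA'.
pose H' := coord_rep iota chi0 phi \o transition chi chi0.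
have HH' y : O' y -> H' y = coord_rep iota chi phi y.
  by move=> [oy _]; rewrite /H' /coord_rep/= cinv_transition.
have sub : O' `<=` cimg chi `&` ((iota \o cinv chi) @^-1` cdom phi).
  move=> y [oy Oty]; have [_] := Osub _ Oty; rewrite /preimage/= cinv_transition// => dy.
  by split=> //; case: oy.
have key u v y X : O' y -> conn_form c iota chi phi (A \o transition chi chi0) u v y X =
    conn_form c iota chi0 phi A u v (transition chi chi0 y)
      (X *m 'J (transition chi chi0) y).
  move=> O'y; rewrite -[RHS]/(frame_form _ _ _ _ _ _ _).
  rewrite -(frame_form_comp isoA st)// -[LHS]/(frame_form _ _ _ _ _ _ _).
  have dH : 'D_X (coord_rep iota chi phi) y = 'D_X H' y.
    by apply/esym/near_eq_derive; exact: (open_near_eq oO' HH').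
  have gen (x1 x2 z1 z2 : 'rV[R]_4) (B B' : 'M[R]_6) : x1 = x2 -> z1 = z2 ->
    ((B' + B *m normal_connection (metric c phi) x1 z1) *m invmx B) (inord u) (inord v) =
    ((B' + B *m normal_connection (metric c phi) x2 z2) *m invmx B) (inord u) (inord v).
    by move=> -> ->.
  exact: gen (esym (HH' y O'y)) dH.
split=> //; split; first by split => //; case: isoA'.
move=> y O'y; have [oy Oty] := O'y; have [e1 e2 e3] := hO _ Oty.
split=> // [|X]; last by rewrite /coframe key//; exact: e3.
by rewrite -HH'.
Qed.

Lemma coord_rep_change chi phi phi0 y X : atlas chi -> atlas phi -> atlas phi0 ->
  cimg chi y -> cdom phi (iota (cinv chi y)) -> cdom phi0 (iota (cinv chi y)) ->
  'D_X (coord_rep iota chi phi) y =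
  'D_X (coord_rep iota chi phi0) y *m
    'J (transition phi0 phi) (coord_rep iota chi phi0 y).
Proof.
move=> achi aphi aphi0 cy dphi dphi0.
have sH0 := coord_rep_smooth achi aphi0; have sH := coord_rep_smooth achi aphi.
have oU : open (cimg chi `&` ((iota \o cinv chi) @^-1` cdom phi)).
  by have [h _] := imm; have [] := h chi achi phi aphi.
have oU0 : open (cimg chi `&` ((iota \o cinv chi) @^-1` cdom phi0)).
  by have [h _] := imm; have [] := h chi achi phi0 aphi0.
have d0 : differentiable (coord_rep iota chi phi0) y.
  exact: smooth_differentiable sH0 (conj cy dphi0).
have oy : overlap phi0 phi (coord_rep iota chi phi0 y).
  split; first exact: cmap_img.
  by rewrite /preimage/= /coord_rep/= cmapK.
have dT := smooth_differentiable (transition_smooth aphi0 aphi) oy.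
have e z : (cimg chi `&` ((iota \o cinv chi) @^-1` cdom phi0)) z ->
    coord_rep iota chi phi z = (transition phi0 phi \o coord_rep iota chi phi0) z.
  by move=> [cz dz]; rewrite /coord_rep /transition/= cmapK.
apply: etrans (near_eq_derive X (open_near_eq oU0 e (conj cy dphi0))) _.
by apply: etrans (derive_comp _ d0 dT) _; exact: deriveEjacobian.
Qed.

(** Up to a nonzero factor [omega^2 omega^3] is the metric on V, and the metrics
    of two charts of M are proportional. *)
Lemma null_cone_frames chi phi phi0 A A0 (O O0 : set 'rV[R]_3) y X :
  first_order_frame c iota chi phi A O -> first_order_frame c iota chi phi0 A0 O0 ->
  O y -> O0 y ->
  coframe c iota chi phi A 2 y X * coframe c iota chi phi A 3 y X = 0 ->
  coframe c iota chi phi0 A0 2 y X * coframe c iota chi phi0 A0 3 y X = 0.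
Proof.
move=> frA frA0 Oy O0y null.
have [[achi aphi _ Osub _] _] := frA; have [[_ aphi0 _ O0sub _] _] := frA0.
have [cy dy] := Osub y Oy; have [_ dy0] := O0sub y O0y.
have isoA := first_order_isotropic frA.
have r0 := point_scale isoA Oy.
have nullG : bform (metric c phi (coord_rep iota chi phi y))
    ('D_X (coord_rep iota chi phi) y) ('D_X (coord_rep iota chi phi) y) = 0.
  have := omega_bform frA X X Oy; rewrite [_ + _ * _]addrC [X in X + _]mulrC null addr0 => /eqP.
  by rewrite mulf_eq0 expf_eq0/= (negbTE r0) => /eqP.
have nullG0 : bform (metric c phi0 (coord_rep iota chi phi0 y))
    ('D_X (coord_rep iota chi phi0) y) ('D_X (coord_rep iota chi phi0) y) = 0.
  have oy : overlap phi0 phi (coord_rep iota chi phi0 y).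
    split; first exact: cmap_img.
    by rewrite /preimage/= /coord_rep/= cmapK.
  have [k k0 ->] := metric_conformal c aphi0 aphi oy.
  rewrite bformZm; apply/eqP; rewrite mulf_eq0; apply/orP; right.
  have eH : transition phi0 phi (coord_rep iota chi phi0 y) = coord_rep iota chi phi y.
    by rewrite /transition /coord_rep/= cmapK.
  rewrite eH; apply/eqP; rewrite -[RHS]nullG.
  have gen (Z Z0 : 'rV[R]_4) (J g : 'M[R]_4) : Z = Z0 *m J ->
    bform (J *m g *m J^T) Z0 Z0 = bform g Z Z.
    by move=> ->; rewrite /bform trmx_mul !mulmxA.
  by apply: gen; exact: coord_rep_change.
have := omega_bform frA0 X X O0y; rewrite nullG0 mulr0 => /esym/eqP.
by rewrite mulrC -mulr2n mulrn_eq0/= => /eqP.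
Qed.

Section Planes.
Variables (Da Db : plane_field V).
Hypothesis planes : isotropic_distributions c iota Da Db.

Lemma planes_in_chart chi y : atlas chi -> cimg chi y ->
  exists phi A (O : set 'rV[R]_3), [/\ first_order_frame c iota chi phi A O, O y &
    forall z X, O z -> (Da chi z X <-> coframe c iota chi phi A 3 z X = 0) /\
                       (Db chi z X <-> coframe c iota chi phi A 2 z X = 0)].
Proof.
move=> achi cy.
have [chi0 [phi [B [A [frA d0 By hB]]]]] := planes (cinv chi y).
have [frA' key] := frame_transport frA achi.
have [[achi0 _ _ _ _] _] := frA.
exists phi, (A \o transition chi chi0), (overlap chi chi0 `&` transition chi chi0 @^-1` B).
split=> // z X [oz Bz]; have [ha hb] := hB _ (X *m 'J (transition chi chi0) z) Bz.
rewrite /coframe !key//; split.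
  exact: iff_trans (dist_compatible Da X achi achi0 oz) ha.
exact: iff_trans (dist_compatible Db X achi achi0 oz) hb.
Qed.

(** A first-order frame determines the two planes up to their order, since
    [A_2] and [A_3] may be exchanged. *)
Lemma null_planes chi phi A (O : set 'rV[R]_3) y X :
  first_order_frame c iota chi phi A O -> O y ->
  coframe c iota chi phi A 2 y X * coframe c iota chi phi A 3 y X = 0 <->
  Da chi y X \/ Db chi y X.
Proof.
move=> frA Oy; have [[achi _ _ Osub _] _] := frA; have [cy _] := Osub y Oy.
have [phi0 [A0 [B [frA0 By h]]]] := planes_in_chart achi cy.
have [ha hb] := h y X By; split=> [n|D].
  have /eqP := null_cone_frames frA frA0 Oy By n; rewrite mulf_eq0.
  by case/orP => /eqP e; [right; apply/hb|left; apply/ha].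
apply: (null_cone_frames frA0 frA By Oy); apply/eqP; rewrite mulf_eq0.
by apply/orP; case: D => [/ha|/hb] ->; [right|left].
Qed.

End Planes.

End Hypersurface.

(** * Integrable distributions make the hypersurface umbilical *)

Section Forward.
Context {R : realType} {M : manifold R 4} (c : conformal22 M).
Context {V : manifold R 3} (iota : V -> M).
Hypothesis imm : immersion iota.

(** On an integral surface of a field of null planes one of [omega^2], [omega^3],
    say [omega^k], vanishes near y, as the product is zero and the other form is
    not zero at y. On the frame induced on the surface, the structure equation
    for [e_1] and [e_(5-k)], which are tangent to it, then gives
    [omega_1^k (e_(5-k)) = 0]. This is [lambda_22] or [lambda_33], depending
    on k, and which of the two it is depends on the frame. *)
Lemma integral_surface_second_form (D : plane_field V) chi phi A (O : set 'rV[R]_3) y :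
  first_order_frame c iota chi phi A O -> O y -> integrable_distribution 2 D ->
  (forall z X, O z -> D chi z X ->
    coframe c iota chi phi A 2 z X * coframe c iota chi phi A 3 z X = 0) ->
  exists2 k, (k == 2)%N || (k == 3)%N &
    (forall X, D chi y X -> coframe c iota chi phi A k y X = 0) /\
    conn_form c iota chi phi A 1 k y (dual_basis c iota chi phi A (5 - k) y) = 0.
Proof.
move=> frA Oy iD null; have isoA := first_order_isotropic imm frA.
have [[achi aphi oO Osub sA] _] := frA; have [cy _] := Osub y Oy.
have [B [h [[oB B0 h0 sh] [_ free tan]]]] := integral_submanifold_chart iD achi cy.
have isoB := isotropic_frame_comp isoA oB sh.
set B' := B `&` h @^-1` O in isoB.
have B'0 : B' 0 by split=> //; rewrite /preimage/= h0.
have [oB' sH2 sA2 _] := isoB.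
pose w k u Z := frame_form (metric c phi) (coord_rep iota chi phi \o h) (A \o h) 0 k u Z.
have wE k u Z : B' u -> w k u Z = coframe c iota chi phi A k (h u) (Z *m 'J h u).
  by move=> Bu; apply: (frame_form_comp isoA sh).
have wlin k u : (k == 2)%N || (k == 3)%N -> B' u ->
    forall a X Y, w k u (a *: X + Y) = a * w k u X + w k u Y.
  by move=> k23 Bu a X Y; apply: (coframe_linear isoB) => //; case/orP: k23 => /eqP->.
have wnull u Z : B' u -> w 2 u Z * w 3 u Z = 0.
  move=> [Bu Ohu]; rewrite !wE//; apply: null => //.
  by apply/tan => //; exact: submxMl.
(* one of the two forms vanishes on the surface at 0, the other one does not *)
have [k k23 [wk0 [Z1 wZ1]]] : exists2 k, (k == 2)%N || (k == 3)%N &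
    (forall Z, w k 0 Z = 0) /\ exists Z, w (5 - k)%N 0 Z != 0.
  have [h2|/existsNP[Z1 /eqP w2]] := pselect (forall Z, w 2 0%R Z = 0); last first.
    exists 3%N => //; split; last by exists Z1.
    exact: linear_forms_product (wlin 2%N 0 isT B'0) (wlin 3%N 0 isT B'0)
      (fun Z => wnull 0 Z B'0) w2.
  exists 2%N => //; split => //; apply/not_existsP => h3.
  have {}h3 Z : w 3%N 0 Z = 0 by apply/eqP/negPn/negP; exact: h3.
  pose w1 Z := coframe c iota chi phi A 1 y (Z *m 'J h 0).
  have w1lin a X Y : w1 (a *: X + Y) = a * w1 X + w1 Y.
    by rewrite /w1 mulmxDl -scalemxAl (omega_linear imm frA).
  have free0 X : w1 X = 0 -> X = 0.
    move=> X1; have [F hF] := row_freeP (free 0 B0).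
    rewrite -[X]mulmx1 -hF mulmxA (_ : X *m 'J h 0 = 0) ?mul0mx//.
    apply: (coframe_free imm frA Oy) => -[|[|[|[|]]]]// _.
      by have := h2 X; rewrite wE// h0.
    by have := h3 X; rewrite wE// h0.
  by have [Z Z0 /free0] := linear_form_kernel2 w1lin; apply/eqP.
set l := (5 - k)%N in wZ1.
have l23 : (l == 2)%N || (l == 3)%N by rewrite /l; case/orP: k23 => /eqP->.
have kl : k = (5 - l)%N by rewrite /l; case/orP: k23 => /eqP->.
have l4 : (0 < l < 4)%N by case/orP: l23 => /eqP->.
have l6 : (0 < l < 6)%N by case/orP: l23 => /eqP->.
have k6 : (0 < k < 6)%N by case/orP: k23 => /eqP->.
have wnull' u Z : B' u -> w l u Z * w k u Z = 0.
  by move=> Bu; have := wnull u Z Bu; rewrite kl; case/orP: l23 => /eqP-> //; rewrite mulrC.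
exists k => //; split.
  by move=> X; rewrite -h0 => /(tan _ _ B0)/submxP[Z ->]; rewrite -wE.
(* omega^l does not vanish near 0, so that omega^k does; eta is used in place of
   the forms, as in the structure equation *)
have dG u : B' u -> differentiable (fun z => metric c phi ((coord_rep iota chi phi \o h) z)) u.
  move=> Bu; have [_ _ _ /(_ u Bu)[dG _ _ _]] := isoB.
  apply: (@differentiable_comp _ _ _ _ (coord_rep iota chi phi \o h) (metric c phi)) => //.
  exact: smooth_differentiable sH2 Bu.
pose eta j u Z := bform (metric c phi ((coord_rep iota chi phi \o h) u))
  ('D_Z (coord_rep iota chi phi \o h) u) (frame_vec (A \o h) (5 - j) u).
have weta j u Z : B' u -> (0 < j < 6)%N ->
  w j u Z = gram_sign (5 - j) * ((A \o h) u ord0 ord0 * eta j u Z).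
  by move=> Bu j6; apply: (coframeE isoB).
have eta0 j u Z : B' u -> (0 < j < 6)%N -> (w j u Z == 0) = (eta j u Z == 0).
  move=> Bu j6; rewrite weta// !mulf_eq0 (negbTE (point_scale isoB Bu)) orFb.
  by rewrite /gram_sign; case: ifP; rewrite ?oppr_eq0 oner_eq0.
have etal1 : eta l 0 Z1 != 0 by rewrite -eta0.
have near_l : \forall u \near (0 : 'rV[R]_2), eta l u Z1 != 0.
  have ce : {for (0 : 'rV[R]_2), continuous (fun u => eta l u Z1)}.
    apply/differentiable_continuous; apply: differentiable_bform; first exact: dG.
      exact: smooth_differentiable (smooth_derive _ sH2) B'0.
    exact: (differentiable_frame_vec isoB).
  by apply: (ce [set x : R | x != 0]); exact: open_nbhs_nbhs (conj (@open_neq _ _) etal1).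
have eta_near Z : \forall u \near (0 : 'rV[R]_2), eta k u Z = 0.
  have nB : nbhs (0 : 'rV[R]_2) B' by exact: open_nbhs_nbhs.
  apply: filterS2 near_l nB => u el Bu; apply/eqP; rewrite -eta0//; apply/eqP.
  have wl : w l u Z1 != 0 by rewrite (eta0 l u Z1 Bu l6).
  exact: linear_forms_product (wlin l u l23 Bu) (wlin k u k23 Bu)
    (fun Z' => wnull' u Z' Bu) wl Z.
(* the tangent plane at y is in the kernel of omega^k, spanned by e_1 and e_l;
   both have dimension 2 *)
have span j : (j == 1)%N || (j == l)%N ->
    exists Z, dual_basis c iota chi phi A j y = Z *m 'J h 0.
  move=> j1l; apply/submxP.
  pose E := col_mx (dual_basis c iota chi phi A 1 y) (dual_basis c iota chi phi A l y).
  have sub : ('J h 0 <= E)%MS.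
    apply/row_subP => i; rewrite rowE; set Z := delta_mx 0 i.
    rewrite (dual_expansion imm frA (Z *m 'J h 0) Oy) -addsmxE.
    have := wk0 Z; rewrite wE// h0.
    case/orP: k23 => /eqP ek; rewrite /l ek => ->; rewrite scale0r ?addr0;
      by apply: addmx_sub_adds; exact: scalemx_sub.
  have rk : \rank ('J h 0) = 2%N by apply/eqP; exact: free.
  have EJ : (E <= 'J h 0)%MS.
    by rewrite -(geq_leqif (mxrank_leqif_sup sub)) rk; exact: rank_leq_row.
  apply: submx_trans EJ; rewrite -addsmxE.
  by case/orP: j1l => /eqP->; [exact: addsmxSl|exact: addsmxSr].
have [X0 eX] := span 1%N isT; have [|Y0 eY] := span l.
  by rewrite eqxx orbT.
have tangent j Z : (0 < j < 4)%N -> dual_basis c iota chi phi A j y = Z *m 'J h 0 ->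
    'D_Z (coord_rep iota chi phi \o h) 0 = (A y ord0 ord0)^-1 *: frame_vec (A \o h) j 0.
  move=> j4 eZ; have [_ sH _ _] := isoA.
  apply: etrans (derive_jacobian_comp sh Z B'0 sH) _; rewrite -eZ h0.
  apply: etrans (tangent_dual imm frA Oy j4) _.
  by rewrite /frame_vec /= h0.
have := structure_equation (k := k) isoB B'0 k23 (tangent 1%N _ isT eX) (tangent _ _ l4 eY).
have zero Z Z' : 'D_Z (fun z => eta k z Z') 0 = 0.
  by apply: etrans (near_eq_derive Z (eta_near Z')) _; exact: (derive_cst (0 : R)).
rewrite -/l; rewrite [X in X - _](zero X0 Y0) [X in _ - X](zero Y0 X0) subrr.
rewrite (frame_form_comp isoA sh)// -eY h0 => /esym/eqP.
by rewrite mulf_eq0 invr_eq0 (negbTE (point_scale isoA Oy)) => /eqP.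
Qed.

(** The two distributions belong to different values of k: otherwise the null
    vector [e_k] would be in neither of them. So both coefficients vanish. *)
Lemma umbilical_of_integrable (Da Db : plane_field V) :
  isotropic_distributions c iota Da Db ->
  integrable_distribution 2 Da -> integrable_distribution 2 Db ->
  totally_umbilical c iota.
Proof.
move=> planes iDa iDb chi phi B A frA y By X.
have np z Z Bz := null_planes imm planes (y := z) Z frA Bz.
have [k k23 [kDa lk]] : exists2 k, (k == 2)%N || (k == 3)%N &
    (forall X, Da chi y X -> coframe c iota chi phi A k y X = 0) /\
    conn_form c iota chi phi A 1 k y (dual_basis c iota chi phi A (5 - k) y) = 0.
  apply: integral_surface_second_form frA By iDa _ => z Z Bz Dz.
  by apply/(np _ _ Bz); left.
have [j j23 [jDb lj]] : exists2 k, (k == 2)%N || (k == 3)%N &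
    (forall X, Db chi y X -> coframe c iota chi phi A k y X = 0) /\
    conn_form c iota chi phi A 1 k y (dual_basis c iota chi phi A (5 - k) y) = 0.
  apply: integral_surface_second_form frA By iDb _ => z Z Bz Dz.
  by apply/(np _ _ Bz); right.
have jk : j != k.
  apply/eqP => e; rewrite e in jDb; have k4 : (0 < k < 4)%N by case/orP: k23 => /eqP->.
  have : Da chi y (dual_basis c iota chi phi A k y) \/
         Db chi y (dual_basis c iota chi phi A k y).
    apply/(np _ _ By); rewrite !(coframe_dual imm frA By)//.
    by case/orP: k23 => /eqP->; rewrite ?mulr0 ?mul0r.
  by case=> [/kDa|/jDb]; rewrite (coframe_dual imm frA By)// eqxx => /eqP;
    rewrite oner_eq0.
have [l22 l33] : lambda22 c iota chi phi A y = 0 /\ lambda33 c iota chi phi A y = 0.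
  rewrite /lambda22 /lambda33.
  by case/orP: k23 jk lk => /eqP-> + lk; case/orP: j23 lj => /eqP-> lj.
rewrite /second_form /second_form_tilde /first_form l22 l33; ring.
Qed.

End Forward.

(** * Umbilical hypersurfaces have integrable distributions *)

Section Backward.
Context {R : realType} {M : manifold R 4} (c : conformal22 M).
Context {V : manifold R 3} (iota : V -> M).
Hypothesis imm : immersion iota.

Lemma ruled_chart (v : V) : geodesics_prolongable c iota ->
  exists chi : chart R 3 V, [/\ atlas chi, cdom chi v & forall z phi,
    cimg chi z -> atlas phi -> cdom phi (iota (cinv chi z)) ->
    on_isotropic_line c iota chi phi z (delta_mx 0 ord_max)].
Proof.
move=> [B [f [_ _ h _]]]; have [chi [psi [k [achi dv _ hz]]]] := h v.
by exists chi; split=> // z phi cz aphi dz; have [_ _] := hz z cz; apply.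
Qed.

(** The isotropic line is the radical of the metric on V, that is of
    [2 omega^2 omega^3]. *)
Lemma isotropic_line_coframe chi phi A (O : set 'rV[R]_3) y X :
  first_order_frame c iota chi phi A O -> O y ->
  on_isotropic_line c iota chi phi y X ->
  coframe c iota chi phi A 2 y X = 0 /\ coframe c iota chi phi A 3 y X = 0.
Proof.
move=> frA Oy line; have dH := frame_differentiable imm frA Oy.
have orth Y : coframe c iota chi phi A 2 y X * coframe c iota chi phi A 3 y Y +
    coframe c iota chi phi A 3 y X * coframe c iota chi phi A 2 y Y = 0.
  rewrite -(omega_bform imm frA)// (_ : bform _ _ _ = 0) ?mulr0//.
  have gen (Z1 Z2 : 'rV[R]_4) (J : 'M[R]_(3, 4)) (g : 'M[R]_4) : Z1 = X *m J ->
    Z2 = Y *m J -> X *m J *m g *m J^T = 0 -> bform g Z1 Z2 = 0.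
    by move=> -> -> e; rewrite /bform trmx_mul mulmxA e mul0mx mxE.
  by apply: gen line; exact: deriveEjacobian.
have o2 := orth (dual_basis c iota chi phi A 3 y).
have o3 := orth (dual_basis c iota chi phi A 2 y).
move: o2 o3; rewrite !(coframe_dual imm frA)//= !mulr1 !mulr0.
by rewrite addr0 add0r.
Qed.

(** [II (e_2) = lambda_22] and [II (e_3) = lambda_33]. *)
Lemma umbilical_coeff chi phi A (O : set 'rV[R]_3) y k :
  totally_umbilical c iota -> first_order_frame c iota chi phi A O -> O y ->
  (k == 2)%N || (k == 3)%N ->
  conn_form c iota chi phi A 1 k y (dual_basis c iota chi phi A (5 - k) y) = 0.
Proof.
move=> umb frA Oy k23.
have h X := umb _ _ _ _ frA y Oy X.
have := h (dual_basis c iota chi phi A (5 - k) y).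
rewrite /second_form /second_form_tilde /first_form /lambda22 /lambda33.
move: (lambda23 _ _ _ _ _ _) => m.
case/orP: k23 => /eqP->; rewrite !(coframe_dual imm frA)//=.
  by rewrite !(mulr0, mulr1, mul0r, expr1n, expr0n, addr0, add0r, subr0).
by rewrite !(mulr0, mulr1, mul0r, expr1n, expr0n, addr0, add0r, subr0).
Qed.

Section Leaf.
Variables (chi : chart R 3 V) (phi : chart R 4 M) (A : 'rV[R]_3 -> 'M[R]_6).
Variables (O : set 'rV[R]_3) (k : nat).
Hypothesis frA : first_order_frame c iota chi phi A O.
Hypothesis k23 : (k == 2)%N || (k == 3)%N.
Hypothesis line : forall z, O z ->
  on_isotropic_line c iota chi phi z (delta_mx 0 ord_max).
Hypothesis flat : forall z, O z ->
  conn_form c iota chi phi A 1 k z (dual_basis c iota chi phi A (5 - k) z) = 0.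

Local Notation H := (coord_rep iota chi phi).
Local Notation omega := (coframe c iota chi phi A).
Local Notation e := (dual_basis c iota chi phi A).
Local Notation l := (5 - k)%N.
Local Notation d3 := (delta_mx 0 ord_max : 'rV[R]_3).

(** This is [omega^k] up to a nonzero factor, in the form in which
    [structure_equation] differentiates it. *)
Definition plane_form : 'rV[R]_3 -> 'rV[R]_3 -> R :=
  locked (fun X z => bform (metric c phi (H z)) ('D_X H z) (frame_vec A l z)).
Definition plane_coeff (i : 'I_3) : 'rV[R]_3 -> R := plane_form (delta_mx 0 i).

Let isoA : isotropic_frame (metric c phi) H A O.
Proof. exact: first_order_isotropic. Qed.
Let oO : open O. Proof. by case: isoA. Qed.
Let sH : smooth_on O H. Proof. by case: isoA. Qed.
Let l4 : (0 < l < 4)%N. Proof. by case/orP: k23 => /eqP->. Qed.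
Let k4 : (0 < k < 4)%N. Proof. by case/orP: k23 => /eqP->. Qed.
Let lk : (l == k) = false. Proof. by case/orP: k23 => /eqP->. Qed.

Lemma plane_formF X :
  plane_form X = fun z => bform (metric c phi (H z)) ('D_X H z) (frame_vec A l z).
Proof. by rewrite /plane_form -lock. Qed.

Lemma omega_plane_form X z : O z -> omega k z X = A z ord0 ord0 * plane_form X z.
Proof.
move=> Oz; have k6 : (0 < k < 6)%N by case/orP: k23 => /eqP->.
apply: etrans (coframeE isoA X Oz k6) _; rewrite plane_formF.
have -> : gram_sign l = 1 :> R by rewrite /gram_sign; case/orP: k23 => /eqP->.
by rewrite mul1r.
Qed.

Lemma plane_form_eq0 X z : O z -> (omega k z X = 0) <-> (plane_form X z = 0).
Proof.
move=> Oz; rewrite omega_plane_form//; split=> [/eqP|->]; last by rewrite mulr0.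
by rewrite mulf_eq0 (negbTE (point_scale isoA Oz)) => /eqP.
Qed.

Lemma plane_form_line z : O z -> plane_form d3 z = 0.
Proof.
move=> Oz; apply/plane_form_eq0 => //.
have [h2 h3] := isotropic_line_coframe frA Oz (line Oz).
by case/orP: k23 => /eqP->.
Qed.

Lemma plane_formE X z : O z ->
  plane_form X z = X 0 0 * plane_coeff 0 z + X 0 1 * plane_coeff 1 z.
Proof.
move=> Oz; have lin a Y Z : plane_form (a *: Y + Z) z =
    a * plane_form Y z + plane_form Z z.
  have dH := frame_differentiable imm frA Oz.
  rewrite !plane_formF -bformZl -bformDl; congr (bform _ _ _).
  exact: derive_linear_dir.
apply: etrans (linear_row_sum (f := plane_form^~ z) lin X) _.
rewrite !big_ord_recl big_ord0 addr0.
have -> : lift ord0 (lift ord0 ord0) = ord_max :> 'I_3 by apply: val_inj.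
rewrite plane_form_line// mulr0 addr0.
by have -> : lift ord0 ord0 = 1 :> 'I_3 by apply: val_inj.
Qed.

Lemma plane_coeff_neq0 z : O z -> plane_coeff 0 z != 0 \/ plane_coeff 1 z != 0.
Proof.
move=> Oz; have [e0|] := eqVneq (plane_coeff 0 z) 0; last by left.
right; apply/eqP => e1; have := coframe_dual imm frA Oz k4 k4.
rewrite omega_plane_form// plane_formE// e0 e1 !mulr0 addr0 mulr0 eqxx => /esym/eqP.
by rewrite oner_eq0.
Qed.

Lemma plane_coeff_smooth i : smooth_on O (plane_coeff i).
Proof.
have [[achi aphi _ Osub sA] _] := frA.
rewrite /plane_coeff plane_formF; apply: smooth_bform => //; last 1 first.
- apply/(smooth_mxP _ oO) => a b; under eq_fun do rewrite /frame_vec mxE mcolsE.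
  by move/(smooth_mxP _ oO) : sA; apply.
- apply: (@smooth_comp R _ _ _ (cimg phi) 4 4 H (metric c phi)) => //.
  + exact: cimg_open.
  + by move=> z /Osub[cz dz]; exact: cmap_img.
  + exact: metric_smooth.
- exact: smooth_derive.
Qed.

(** With [a_i] for [plane_coeff i], the structure equation for the directions
    d/dt and [e_l] reads [e_l^0 a_0' + e_l^1 a_1' = 0], because d/dt is in the
    kernel of [omega^k] everywhere and [omega_1^k (e_l) = 0]. As [e_l] is in this
    kernel too, [e_l^0 a_0 + e_l^1 a_1 = 0]. *)
Lemma plane_coeff_wronskian z : O z ->
  'D_d3 (plane_coeff 0) z * plane_coeff 1 z = plane_coeff 0 z * 'D_d3 (plane_coeff 1) z.
Proof.
move=> Oz; set Y := e l z.
have HY := tangent_dual imm frA Oz l4.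
have r0 := point_scale isoA Oz.
have [h2 h3] := isotropic_line_coframe frA Oz (line Oz).
have HX : 'D_d3 H z = ((A z ord0 ord0)^-1 * omega 1 z d3) *: frame_vec A 1 z.
  apply: (scalerI r0); rewrite scalerA mulrA mulfV// mul1r.
  by rewrite (tangent_expansion3 imm frA)// h2 h3 !scale0r !addr0.
have se := structure_equation (k := k) isoA Oz k23 HX HY.
have e0 : 'D_Y (fun z => bform (metric c phi (H z)) ('D_d3 H z) (frame_vec A l z)) z = 0.
  apply: (derive_cst_on (c := 0) Y oO _ Oz) => z' Oz'.
  by have := plane_form_line Oz'; rewrite plane_formF.
have sub0 (p q r s : R) : p - q = r * s -> q = 0 -> s = 0 -> p = 0.
  by move=> h q0 s0; rewrite q0 s0 subr0 mulr0 in h.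
have e1 := sub0 _ _ _ _ se e0 (flat Oz).
have d i : differentiable (plane_coeff i) z.
  exact: smooth_differentiable (plane_coeff_smooth i) Oz.
have DY : 'D_d3 (fun z => bform (metric c phi (H z)) ('D_Y H z) (frame_vec A l z)) z =
    Y 0 0 * 'D_d3 (plane_coeff 0) z + Y 0 1 * 'D_d3 (plane_coeff 1) z.
  have eq z' : O z' -> bform (metric c phi (H z')) ('D_Y H z') (frame_vec A l z') =
      Y 0 0 * plane_coeff 0 z' + Y 0 1 * plane_coeff 1 z'.
    by move=> Oz'; rewrite -plane_formE// plane_formF.
  apply: etrans (near_eq_derive _ (open_near_eq oO eq Oz)) _.
  have dm i (a : R) : is_derive z d3 (fun z => a * plane_coeff i z)
      (a * 'D_d3 (plane_coeff i) z).
    have : derivable (plane_coeff i) z d3 by exact: diff_derivable.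
    by move/derivableP; exact: is_deriveZ.
  by have [] := is_deriveD (dm 0 (Y 0 0)) (dm 1 (Y 0 1)).
have {}e1 := etrans (esym DY) e1.
have e2 : Y 0 0 * plane_coeff 0 z + Y 0 1 * plane_coeff 1 z = 0.
  rewrite -plane_formE//; apply/plane_form_eq0 => //.
  by rewrite (coframe_dual imm frA)// lk.
have Y01 : Y 0 0 != 0 \/ Y 0 1 != 0.
  have [y0|] := eqVneq (Y 0 0) 0; last by left.
  right; apply/eqP => y1; have := coframe_dual imm frA Oz l4 l4.
  have -> : e l z = Y 0 ord_max *: d3 + 0.
    by rewrite addr0; exact: row3_last.
  have -> : omega l z (Y 0 ord_max *: d3 + 0) = 0.
    rewrite (omega_linear imm frA)//.
    have -> : omega l z d3 = 0 by case/orP: k23 => /eqP->.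
    rewrite mulr0 add0r; apply: linear_form0 => a X' Y'.
    exact: (omega_linear imm frA).
  by rewrite eqxx => /esym/eqP; rewrite oner_eq0.
exact: common_zero_proportional e1 e2 Y01.
Qed.

(** The Wronskian of the two coefficients along the t-lines being zero, their
    ratio is constant on a segment on which one of them does not vanish. *)
Lemma plane_coeff_proportional y r z t i : ball y r `<=` O ->
  (i == 0) || (i == 1) ->
  (forall z, ball y r z -> plane_coeff i z != 0) ->
  ball y r z -> ball y r (z + t *: d3) ->
  plane_coeff 0 (z + t *: d3) * plane_coeff 1 z =
  plane_coeff 1 (z + t *: d3) * plane_coeff 0 z.
Proof.
move=> bO i01 ni bz bzt.
have seg s : 0 <= s <= 1 -> ball y r (z + s *: (t *: d3)).
  move=> s01; have := ball_segment bzt bz s01.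
  by rewrite [z + t *: d3]addrC addrK.
have dif j z' : O z' -> differentiable (plane_coeff j) z'.
  exact: smooth_differentiable (plane_coeff_smooth j).
have der j (s : R) : 0 <= s <= 1 -> is_derive s 1 (fun s : R => plane_coeff j (z + s *: (t *: d3)))
    (t * 'D_d3 (plane_coeff j) (z + s *: (t *: d3))).
  move=> s01; have dj := dif j _ (bO _ (seg s s01)).
  have := is_derive_line dj; rewrite [X in is_derive _ _ _ X](_ : _ =
    t * 'D_d3 (plane_coeff j) (z + s *: (t *: d3)))//.
  by rewrite deriveE// linearZ/= deriveE.
have wr s : 0 <= s <= 1 ->
    t * 'D_d3 (plane_coeff 0) (z + s *: (t *: d3)) * plane_coeff 1 (z + s *: (t *: d3)) =
    plane_coeff 0 (z + s *: (t *: d3)) * (t * 'D_d3 (plane_coeff 1) (z + s *: (t *: d3))).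
  move=> s01; have := plane_coeff_wronskian (bO _ (seg s s01)).
  by rewrite -mulrA => ->; rewrite mulrCA.
case/orP: i01 ni => /eqP-> ni.
  have := proportional_of_wronskian (der 1) (der 0) _ (fun s s01 => ni _ (seg s s01)).
  rewrite !scale1r !scale0r !addr0 => h; rewrite -h// => s s01.
  by rewrite mulrC -wr// mulrC.
have := proportional_of_wronskian (der 0) (der 1) wr (fun s s01 => ni _ (seg s s01)).
by rewrite !scale1r !scale0r !addr0.
Qed.

(** This is [(- a_1, a_0, 0)], which with the direction of t spans the kernel of
    [omega^k]. *)
Definition leaf_field (z : 'rV[R]_3) : 'rV[R]_3 :=
  \row_i ((i == 1)%:R * plane_coeff 0 z + - (i == 0)%:R * plane_coeff 1 z).

Lemma leaf_field_smooth : smooth_on O leaf_field.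
Proof.
apply/(smooth_mxP _ oO) => a i; under eq_fun do rewrite mxE.
by apply: smoothD => //; apply: smoothMl => //; exact: plane_coeff_smooth.
Qed.

(** The surface is swept out by the t-lines through an integral curve of
    [leaf_field]. Along the curve its tangent plane is the kernel of [omega^k] by
    construction; away from it, because this kernel is invariant under
    translation along t. *)
Lemma integral_leaf y : O y ->
  exists (B : set 'rV[R]_2) (h : 'rV[R]_2 -> 'rV[R]_3),
    [/\ open B, B 0, h 0 = y & smooth_on B h] /\
    [/\ forall u, B u -> O (h u), forall u, B u -> row_free ('J h u) &
        forall u X, B u -> omega k (h u) X = 0 <-> (X <= 'J h u)%MS].
Proof.
move=> Oy.
have [i i01 ai] : exists2 i : 'I_3, (i == 0) || (i == 1) & plane_coeff i y != 0.
  by have [h|h] := plane_coeff_neq0 Oy; [exists 0|exists 1].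
have nO : nbhs y O by exact: open_nbhs_nbhs.
have na : \forall z \near y, plane_coeff i z != 0.
  have ca : {for y, continuous (plane_coeff i)}.
    apply/differentiable_continuous.
    exact: smooth_differentiable (plane_coeff_smooth i) Oy.
  by apply: (ca [set x : R | x != 0]); exact: open_nbhs_nbhs (conj (@open_neq _ _) ai).
have /nbhs_ballP[r /= r0 rsub] : nbhs y [set z | O z /\ plane_coeff i z != 0].
  by apply: filterS2 nO na => z; split.
have bO : ball y r `<=` O by move=> z /rsub[].
have bi z : ball y r z -> plane_coeff i z != 0 by move=> /rsub[].
have r20 : 0 < r / 2 by rewrite divr_gt0.
have sub2 : ball y (r / 2) `<=` ball y r.
  by apply: le_ball; rewrite ler_pdivrMr// ler_peMr ?ltW// ltr1n.
have o2 : open (ball y (r / 2)) by exact: ball_open.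
have [gam [del [del0 gam0 hgam]]] := integral_curve o2
  (smooth_sub (subset_trans sub2 bO) leaf_field_smooth) (ballxx y r20).
pose B : set 'rV[R]_2 := (fun u => u 0 0) @^-1` ball (0 : R) del `&`
  (fun u => u 0 1) @^-1` ball (0 : R) (r / 2).
pose h (u : 'rV[R]_2) : 'rV[R]_3 := gam (u 0 0) + u 0 1 *: d3.
have BE u : B u -> `|u 0 0| < del /\ `|u 0 1| < r / 2.
  by case; rewrite /preimage/= -!ball_normE/= !sub0r !normrN.
have oB : open B.
  by apply: openI; apply: open_comp; try exact: ball_open;
    move=> u _; exact: coord_continuous.
have gb u : B u -> ball y (r / 2) (gam (u 0 0)) by move=> /BE[/hgam[]].
have hb u : B u -> ball y r (h u).
  move=> Bu; have := gb u Bu; have [_ u1] := BE u Bu; rewrite -!ball_normE/= => g1.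
  rewrite /h opprD addrA; apply: le_lt_trans (ler_normB _ _) _.
  rewrite [r]splitr; apply: ltrD => //; apply: le_lt_trans u1.
  rewrite normrZ ler_piMr//; apply: mx_norm_le => // a b; rewrite mxE.
  by case: (_ && _); rewrite ?normr1 ?normr0.
have dgam u v : B u -> differentiable (fun x : 'rV[R]_2 => gam (x 0 0)) u /\
    'D_v (fun x : 'rV[R]_2 => gam (x 0 0)) u = v 0 0 *: leaf_field (gam (u 0 0)).
  move=> Bu; have [/hgam[_ dg eg] _] := BE u Bu.
  by have [h1 h2] := derive_row_curve v dg; rewrite -eg.
have sgam : smooth_on B (fun x : 'rV[R]_2 => gam (x 0 0)).
  apply: (@smooth_ode R _ 3 B (ball y (r / 2)) _ (fun v z => v 0 0 *: leaf_field z)) => //.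
  - by move=> u Bu; have [] := dgam u 0 Bu.
  - move=> v; apply: smoothZ; first exact: ball_open.
    exact: smooth_sub (subset_trans sub2 bO) leaf_field_smooth.
  - by move=> v u Bu; have [] := dgam u v Bu.
have slin : smooth_on B (fun u : 'rV[R]_2 => u 0 1 *: d3).
  apply/(smooth_mxP _ oB) => a b; under eq_fun do rewrite mxE mulrC.
  by apply: smoothMl => //; exact: smooth_coord.
have sh : smooth_on B h by exact: smoothD.
have Dh u X : B u -> X *m 'J h u = X 0 0 *: leaf_field (gam (u 0 0)) + X 0 1 *: d3.
  move=> Bu; rewrite -deriveEjacobian; last exact: smooth_differentiable sh Bu.
  have [d1 e1] := dgam u X Bu.
  have dc : differentiable (fun x : 'rV[R]_2 => x 0 1) u by exact: differentiable_coord.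
  have d2 : differentiable (fun x : 'rV[R]_2 => x 0 1 *: d3) u.
    exact: differentiableZl.
  have p1 : derivable (fun x : 'rV[R]_2 => gam (x 0 0)) u X by exact: diff_derivable.
  have p2 : derivable (fun x : 'rV[R]_2 => x 0 1 *: d3) u X by exact: diff_derivable.
  apply: etrans (deriveD p1 p2) _.
  rewrite e1; congr (_ + _); apply: etrans (deriveE _ d2) _.
  by rewrite diffZl// -deriveE// derive_coord.
have prop u : B u -> plane_coeff 0 (h u) * plane_coeff 1 (gam (u 0 0)) =
    plane_coeff 1 (h u) * plane_coeff 0 (gam (u 0 0)).
  move=> Bu; apply: (plane_coeff_proportional bO i01 bi); first exact/sub2/gb.
  exact: hb.
exists B, h; split; split => //.
- by split; rewrite /preimage/= mxE; exact: ballxx.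
- by rewrite /h !mxE gam0 scale0r addr0.
- by move=> u /hb/bO.
- move=> u Bu; rewrite -kermx_eq0; apply/rowV0P => X /sub_kermxP; rewrite Dh// => e0.
  have X1 : X 0 1 = 0.
    by have /rowP/(_ ord_max) := e0; rewrite !mxE/=; lra.
  have X0 : X 0 0 = 0.
    have /rowP/(_ 0) := e0; have /rowP/(_ 1) := e0; rewrite !mxE/= X1 !mul0r.
    by have [n|n] := plane_coeff_neq0 (bO _ (sub2 _ (gb u Bu))) => h1 h2;
      apply: (mulIf n); rewrite mul0r; lra.
  apply/rowP => -[[|[|]]]// j; rewrite mxE.
    by rewrite -[RHS]X0; congr (X _ _); apply: val_inj.
  by rewrite -[RHS]X1; congr (X _ _); apply: val_inj.
- move=> u X Bu; have Ohu := bO _ (hb u Bu).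
  have eqv := prop u Bu; rewrite (plane_form_eq0 X Ohu) plane_formE//.
  have nh := plane_coeff_neq0 Ohu.
  have ng := plane_coeff_neq0 (bO _ (sub2 _ (gb u Bu))).
  split=> [e0|/submxP[Z ->]]; last first.
    rewrite Dh// !mxE/=; transitivity (Z 0 0 * (plane_coeff 1 (h u) *
      plane_coeff 0 (gam (u 0 0)) - plane_coeff 0 (h u) * plane_coeff 1 (gam (u 0 0)))).
      by ring.
    by rewrite eqv subrr mulr0.
  have [t [ep eq]] := proportional_kernel eqv nh ng e0.
  apply/submxP; exists (\row_(j < 2) if j == 0 then t else X 0 ord_max).
  rewrite Dh// !mxE/=; apply/rowP => -[[|[|[|]]]]// j; rewrite !mxE -!val_eqE/=.
  + have -> : Ordinal j = 0 :> 'I_3 by apply: val_inj.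
    by rewrite ep; ring.
  + have -> : Ordinal j = 1 :> 'I_3 by apply: val_inj.
    by rewrite eq; ring.
  + have -> : Ordinal j = ord_max :> 'I_3 by apply: val_inj.
    by ring.
Qed.

End Leaf.

Lemma integrable_of_umbilical (D : plane_field V) k : (k == 2)%N || (k == 3)%N ->
  geodesics_prolongable c iota -> totally_umbilical c iota ->
  (forall chi y, atlas chi -> cimg chi y ->
    exists phi A (O : set 'rV[R]_3), [/\ first_order_frame c iota chi phi A O, O y &
      forall z X, O z -> D chi z X <-> coframe c iota chi phi A k z X = 0]) ->
  integrable_distribution 2 D.
Proof.
move=> k23 prol umb planes v.
have [chi [achi dv line]] := ruled_chart v prol.
have [phi [A [B [frA By hD]]]] := planes chi (cmap chi v) achi (cmap_img dv).
have [[_ aphi _ Bsub _] _] := frA.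
have lineB z : B z -> on_isotropic_line c iota chi phi z (delta_mx 0 ord_max).
  by move=> /Bsub[cz dz]; exact: line.
have flat z : B z ->
    conn_form c iota chi phi A 1 k z (dual_basis c iota chi phi A (5 - k) z) = 0.
  by move=> Bz; exact: umbilical_coeff umb frA Bz k23.
have [S [h [[oS S0 h0 sh] [hB free tan]]]] := integral_leaf frA k23 lineB flat By.
exists chi, S, h; split; split => //.
  by move=> u /hB/Bsub[].
by move=> u X Su; apply: iff_trans (hD _ _ (hB u Su)) (tan u X Su).
Qed.

End Backward.

Theorem theorem3 (R : realType) (M : manifold R 4) (c : conformal22 M)
    (V : manifold R 3) (iota : V -> M) (Dalpha Dbeta : plane_field V)
    (V_lightlike : lightlike_hypersurface c iota)
    (V_prolongable : geodesics_prolongable c iota)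
    (V_planes : isotropic_distributions c iota Dalpha Dbeta) :
  integrable_distribution 2 Dalpha /\ integrable_distribution 2 Dbeta <->
  totally_umbilical c iota.
Proof.
have [imm _] := V_lightlike.
split=> [[ia ib]|umb]; first exact: umbilical_of_integrable V_planes ia ib.
have planes := planes_in_chart imm V_planes.
split.
  apply: (integrable_of_umbilical imm (k := 3) isT V_prolongable umb) => chi y achi cy.
  have [phi [A [B [frA By hD]]]] := planes chi y achi cy.
  by exists phi, A, B; split=> // z X /(hD z X)[].
apply: (integrable_of_umbilical imm (k := 2) isT V_prolongable umb) => chi y achi cy.
have [phi [A [B [frA By hD]]]] := planes chi y achi cy.
by exists phi, A, B; split=> // z X /(hD z X)[].
Qed.
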